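(* Let $m,n$ be positive integers. The multigraph $\mathcal{M}_{m,n}$ admits a generating knight's tour if and only if none of the following hold: (i) $m$ and $n$ are both even; (ii) $m\in\{1,2,4\}$; (iii) $m=3$ and $n\in\{1,2,4\}$; (iv) $m=5$ and $n=1$.
   Context: For a positive integer $m$, let $\mathcal{S}_m$ be the graph with vertex set $\{(a,b)\in\mathbb{Z}^2 : 0\le a<m\}$, where $(a,b)$ and $(a',b')$ are joined by an edge iff $\{|a-a'|,|b-b'|\}=\{1,2\}$. For a positive integer $n$, the map $\sigma(a,b)=(m-1-a,\,b+n)$ is a graph automorphism of $\mathcal{S}_m$ generating a free $\mathbb{Z}$-action; the knight's multigraph of the $m\times n$ Möbius strip board is the quotient $\mathcal{M}_{m,n}=\mathcal{S}_m/\langle\sigma\rangle$ (vertices and edges are orbits; multiple edges and loops may occur), and the quotient map $\phi_M:\mathcal{S}_m\to\mathcal{M}_{m,n}$ is a covering map. A knight's tour is a closed walk visiting every vertex exactly once apart from the repeated start/end vertex (a Hamiltonian cycle). Regard a tour as a closed walk starting and ending at the vertex $(0,0)$; it lifts uniquely to a walk in $\mathcal{S}_m$ starting at $(0,0)$. The tour is generating if this lift ends at $(m-1,n)$ or at $(m-1,-n)$ (equivalently, the corresponding closed curve represents a generator of the fundamental group $\cong\mathbb{Z}$ of the Möbius strip). *)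

(* Defs.v *)
From Stdlib Require Import ZArith Lia.
Open Scope Z_scope.

Definition point := (Z * Z)%type.

Definition in_strip (m : Z) (p : point) : Prop := 0 <= fst p < m.

Definition knight_adj (p q : point) : Prop :=
  (Z.abs (fst p - fst q) = 1 /\ Z.abs (snd p - snd q) = 2) \/
  (Z.abs (fst p - fst q) = 2 /\ Z.abs (snd p - snd q) = 1).

Definition strip_edge (m : Z) (p q : point) : Prop :=
  in_strip m p /\ in_strip m q /\ knight_adj p q.

Definition sigma (m n : Z) (p : point) : point := (m - 1 - fst p, snd p + n).
Definition sigma_inv (m n : Z) (p : point) : point := (m - 1 - fst p, snd p - n).

Definition sigma_pow (m n k : Z) (p : point) : point :=
  if 0 <=? k then Nat.iter (Z.to_nat k) (sigma m n) p
  else Nat.iter (Z.to_nat (- k)) (sigma_inv m n) p.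

(* Two points of S_m project to the same vertex of M_{m,n}
   (same orbit under <sigma>). *)
Definition same_vertex (m n : Z) (p q : point) : Prop :=
  exists k : Z, q = sigma_pow m n k p.

(* A knight's tour of M_{m,n} regarded as a closed walk based at the vertex
   phi(0,0), given through its unique lift w to S_m starting at (0,0):
   w 0, ..., w N with N = m*n = number of vertices of M_{m,n};
   consecutive lifted points are adjacent in S_m (so the projected steps are
   edges of M_{m,n}, and every walk of M_{m,n} from phi(0,0) arises this way),
   the projections of w 0, ..., w (N-1) are pairwise distinct and exhaust the
   vertices of M_{m,n}, and the walk closes up: phi(w N) = phi(w 0). *)
Definition is_lifted_tour (m n : Z) (w : nat -> point) : Prop :=
  let N := Z.to_nat (m * n) in
  w 0%nat = (0, 0) /\
  (forall i : nat, (i < N)%nat -> strip_edge m (w i) (w (S i))) /\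
  (forall i j : nat, (i < N)%nat -> (j < N)%nat ->
      same_vertex m n (w i) (w j) -> i = j) /\
  (forall q : point, in_strip m q ->
      exists i : nat, (i < N)%nat /\ same_vertex m n q (w i)) /\
  same_vertex m n (w 0%nat) (w N).

Definition is_generating_lift (m n : Z) (w : nat -> point) : Prop :=
  let N := Z.to_nat (m * n) in
  w N = (m - 1, n) \/ w N = (m - 1, - n).

Definition has_generating_tour (m n : Z) : Prop :=
  exists w : nat -> point, is_lifted_tour m n w /\ is_generating_lift m n w.

(* Main.v *)
(* Existence: a closed walk may be enlarged by stretching the board and
   inserting detours along some of its edges; the new walk is again closed with
   the same winding, so only lengths and coverage have to be checked.
   - Widening, m to m + 4: if the tour uses every boundary edge
     (0,b)--(1,b+2) and its images under sigma ("rungs"), each is replaced by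
     (0,b), (-2,b+1), (-1,b+3), (1,b+2); the middle edges are the rungs of the
     wider strip, so this can be iterated.
   - Lengthening, n to n + 4: the edges crossing one transversal cut are
     replaced by disjoint paths through an inserted block of 4 columns.  Each
     path ends with a translate of the edge it replaces, so the tour crosses the
     new cut in the same way and this can be iterated too.
   Starting tours for 3 <= m <= 9 and small n come from a computer search.

   Non-existence: a knight's move changes the parity of a + b; for m = 2 it
   changes the row; for m = 4 the outer rows are joined only to the inner ones
   and hold half of the vertices, so a tour alternates between them, and with the
   first colouring this leaves out half of the vertices when n is odd.  The four
   remaining boards are searched exhaustively. *)

Require Import Defs.
From Stdlib Require Import ZArith.
From Stdlib Require Import String Ascii Lia List Bool Permutation.
Import ListNotations.
Open Scope Z_scope.

(** * Lifted tours and detours *)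

Notation edge := (point * point)%type.

(** Closed form of [sigma_pow]: the row reflection is an involution, so only the parity of [k] acts
    on rows, while columns move by [k * n]. This turns the group law into arithmetic. *)
Definition sg (m n k : Z) (p : point) : point :=
  ((if Z.even k then fst p else m - 1 - fst p), snd p + k * n).

Definition sge (m n k : Z) (e : edge) : edge :=
  (sg m n k (fst e), sg m n k (snd e)).

Definition swap (e : edge) : edge := (snd e, fst e).

Lemma sg_sg m n j k p : sg m n j (sg m n k p) = sg m n (j + k) p.
Proof.
  unfold sg; cbn [fst snd]; rewrite Z.even_add.
  destruct (Z.even j), (Z.even k); cbn; f_equal; lia.
Qed.

Lemma sg_0 m n p : sg m n 0 p = p.
Proof. destruct p; unfold sg; cbn; f_equal; lia. Qed.

Lemma sg_inv m n j k p q : sg m n j p = sg m n k q -> p = sg m n (k - j) q.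
Proof.
  intros H; apply (f_equal (sg m n (- j))) in H; rewrite !sg_sg in H.
  replace (- j + j) with 0 in H by lia; rewrite sg_0 in H.
  rewrite H; f_equal; lia.
Qed.

Lemma sge_sge m n j k e : sge m n j (sge m n k e) = sge m n (j + k) e.
Proof. unfold sge; cbn [fst snd]; now rewrite !sg_sg. Qed.

Lemma sge_0 m n e : sge m n 0 e = e.
Proof. destruct e; unfold sge; cbn [fst snd]; now rewrite !sg_0. Qed.

Lemma swap_sge m n k e : swap (sge m n k e) = sge m n k (swap e).
Proof. reflexivity. Qed.

Lemma swap_swap e : swap (swap e) = e.
Proof. now destruct e. Qed.

Lemma sigma_pow_sg m n k p : sigma_pow m n k p = sg m n k p.
Proof.
  assert (H1 : forall q, sigma m n q = sg m n 1 q).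
  { intros q; unfold sigma, sg; cbn [Z.even]; f_equal; lia. }
  assert (H2 : forall q, sigma_inv m n q = sg m n (-1) q).
  { intros q; unfold sigma_inv, sg; cbn [Z.even]; f_equal; lia. }
  assert (H : forall f j, (forall q, f q = sg m n j q) ->
            forall i, Nat.iter i f p = sg m n (Z.of_nat i * j) p).
  { intros f j Hf; induction i as [|i IH].
    - symmetry; apply sg_0.
    - change (Nat.iter (S i) f p) with (f (Nat.iter i f p)).
      rewrite IH, Hf, sg_sg; f_equal; lia. }
  unfold sigma_pow; destruct (Z.leb_spec 0 k).
  - rewrite (H _ _ H1); f_equal; lia.
  - rewrite (H _ _ H2); f_equal; lia.
Qed.

Lemma same_vertex_sg m n p q : same_vertex m n p q <-> exists k, q = sg m n k p.
Proof. unfold same_vertex; split; intros [k H]; exists k; rewrite sigma_pow_sg in *; exact H. Qed.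

Lemma in_strip_sg m n k p : in_strip m (sg m n k p) <-> in_strip m p.
Proof. unfold in_strip, sg; cbn [fst]; destruct (Z.even k); lia. Qed.

Lemma strip_edge_sg m n k p q :
  strip_edge m (sg m n k p) (sg m n k q) <-> strip_edge m p q.
Proof.
  unfold strip_edge; rewrite !in_strip_sg.
  enough (H : knight_adj (sg m n k p) (sg m n k q) <-> knight_adj p q) by tauto.
  unfold knight_adj, sg; cbn [fst snd].
  replace (snd p + k * n - (snd q + k * n)) with (snd p - snd q) by lia.
  destruct (Z.even k); [reflexivity|].
  replace (m - 1 - fst p - (m - 1 - fst q)) with (- (fst p - fst q)) by lia.
  now rewrite Z.abs_opp.
Qed.

Lemma strip_edge_sym m p q : strip_edge m p q -> strip_edge m q p.
Proof. unfold strip_edge, knight_adj; intuition lia. Qed.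

(** The final vertex [z] is kept apart from [l], so that the sources of the edges are exactly [l];
    as default of [hd] it becomes the target of the last edge. *)
Fixpoint walk_edges (l : list point) (z : point) : list edge :=
  match l with
  | [] => []
  | p :: l' => (p, hd z l') :: walk_edges l' z
  end.

Lemma length_walk_edges l z : length (walk_edges l z) = length l.
Proof. induction l; cbn; congruence. Qed.

Lemma map_fst_walk_edges l z : map fst (walk_edges l z) = l.
Proof. induction l; cbn; congruence. Qed.

Lemma walk_edges_app l1 l2 z :
  walk_edges (l1 ++ l2) z = walk_edges l1 (hd z l2) ++ walk_edges l2 z.
Proof.
  induction l1 as [|p l1 IH]; cbn; [reflexivity|].
  rewrite IH; destruct l1; reflexivity.
Qed.

Lemma walk_edges_map (h : point -> point) l z :
  walk_edges (map h l) (h z) = map (fun e => (h (fst e), h (snd e))) (walk_edges l z).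
Proof.
  induction l as [|p l IH]; cbn; [reflexivity|].
  rewrite IH; destruct l; reflexivity.
Qed.

(** The walk may start at any lift of any vertex. Ending at the image of its start under [sigma]
    builds in the generating property, and distinctness of the vertices follows from length and
    coverage by pigeonhole ([tour_NoDup]). *)
Record tour (m n : Z) (es : list edge) : Prop := {
  tour_closed : exists l, es = walk_edges l (sg m n 1 (hd (0, 0) l));
  tour_steps : forall e, In e es -> strip_edge m (fst e) (snd e);
  tour_length : Z.of_nat (length es) = m * n;
  tour_cover : forall q, in_strip m q -> exists k e, In e es /\ fst e = sg m n k q }.

Definition detour_walk (f : point -> point) (D : edge -> list point) (e : edge) : list edge :=
  walk_edges (f (fst e) :: D e) (f (snd e)).

Lemma walk_edges_detour f D l z :
  walk_edges (flat_map (fun e => f (fst e) :: D e) (walk_edges l z)) (f z)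
  = flat_map (detour_walk f D) (walk_edges l z).
Proof.
  induction l as [|p l IH]; [reflexivity|].
  cbn [walk_edges flat_map]. rewrite walk_edges_app, IH; f_equal.
  unfold detour_walk; cbn [fst snd]; f_equal.
  destruct l; reflexivity.
Qed.

(** The common engine of widening and lengthening. Consecutive detours fit together because each
    runs from [f (fst e)] to [f (snd e)], and the new walk closes up because [f] intertwines the two
    actions of [sigma]. *)
Lemma detour_tour m n m' n' es f D :
  tour m n es ->
  (forall k p, f (sg m n k p) = sg m' n' k (f p)) ->
  (forall e e', In e es -> In e' (detour_walk f D e) -> strip_edge m' (fst e') (snd e')) ->
  Z.of_nat (length (flat_map D es)) = m' * n' - m * n ->
  (forall q, in_strip m' q ->
     (exists k p, in_strip m p /\ q = sg m' n' k (f p)) \/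
     (exists k e, In e es /\ In (sg m' n' k q) (D e))) ->
  tour m' n' (flat_map (detour_walk f D) es).
Proof.
  intros [[l Hl] Hs Hlen Hc] Hf Hs' Hlen' Hc'; split.
  - destruct l as [|p l]; [exists []; rewrite Hl; reflexivity|].
    exists (flat_map (fun e => f (fst e) :: D e) es).
    rewrite Hl at 1; rewrite <- walk_edges_detour, <- Hl; f_equal.
    rewrite Hf; f_equal; rewrite Hl; reflexivity.
  - intros e' He'; apply in_flat_map in He' as (e & He & He'); eauto.
  - replace (length (flat_map (detour_walk f D) es))
      with (length es + length (flat_map D es))%nat; [lia|].
    clear; induction es as [|e es IH]; [reflexivity|].
    cbn [flat_map]; rewrite !length_app, <- IH; unfold detour_walk.
    rewrite length_walk_edges; cbn [length]; lia.
  - assert (Hin : forall q e, In e es -> In q (f (fst e) :: D e) ->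
              exists e', In e' (flat_map (detour_walk f D) es) /\ fst e' = q).
    { intros q e He Hq; unfold detour_walk.
      rewrite <- (map_fst_walk_edges _ (f (snd e))) in Hq.
      apply in_map_iff in Hq as (e' & Hq & He'); exists e'; split; [|assumption].
      apply in_flat_map; eauto. }
    intros q Hq; destruct (Hc' q Hq) as [(k & p & Hp & ->)|(k & e & He & Hk)].
    + destruct (Hc p Hp) as (j & e & He & Hj).
      destruct (Hin (f (fst e)) e He) as (e' & He' & Hq'); [now left|].
      exists (j - k), e'; split; [assumption|].
      rewrite Hq', Hj, Hf, sg_sg; f_equal; lia.
    + destruct (Hin _ e He (or_intror Hk)) as (e' & He' & Hq'); eauto.
Qed.

(** * Widening the strip *)

(** Rungs point towards increasing columns. The map [sigma] keeps this direction and exchanges the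
    two sides of the strip, so both sides are included. *)
Definition rung (m : Z) (e : edge) : bool :=
  let '((a, b), (a', b')) := e in
  ((a =? 0) && (a' =? 1) || (a =? m - 1) && (a' =? m - 2)) && (b' =? b + 2).

Definition rim (m : Z) (e : edge) : bool := rung m e || rung m (swap e).

(** There are [2 * n] orbits of rungs, [n] for each side, so coverage together with the count says
    that each orbit is used exactly once. *)
Record rimmed (m n : Z) (es : list edge) : Prop := {
  rimmed_cover : forall e, rung m e = true ->
    exists k e', In e' es /\ (e' = sge m n k e \/ e' = sge m n k (swap e));
  rimmed_count : Z.of_nat (length (filter (rim m) es)) = 2 * n }.

Lemma rung_spec m a b a' b' :
  rung m ((a, b), (a', b')) = true <->
  (a = 0 /\ a' = 1 \/ a = m - 1 /\ a' = m - 2) /\ b' = b + 2.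
Proof.
  unfold rung.
  rewrite andb_true_iff, orb_true_iff, !andb_true_iff, !Z.eqb_eq; reflexivity.
Qed.

Lemma rung_sge m n k e : rung m (sge m n k e) = rung m e.
Proof.
  destruct e as [[a b] [a' b']]; apply eq_true_iff_eq.
  unfold sge, sg; cbn [fst snd]; rewrite !rung_spec.
  destruct (Z.even k); lia.
Qed.

Lemma rim_sge m n k e : rim m (sge m n k e) = rim m e.
Proof. unfold rim; now rewrite swap_sge, !rung_sge. Qed.

Lemma rim_swap m e : rim m (swap e) = rim m e.
Proof. unfold rim; rewrite swap_swap; apply orb_comm. Qed.

Lemma length_filter_flat_map {A B} (P : B -> bool) (Q : A -> bool) (F : A -> list B) l :
  (forall x, In x l -> length (filter P (F x)) = if Q x then 1%nat else 0%nat) ->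
  length (filter P (flat_map F l)) = length (filter Q l).
Proof.
  induction l as [|x l IH]; intros H; [reflexivity|].
  cbn [flat_map filter]; rewrite filter_app, length_app, IH by (intros; apply H; now right).
  rewrite H by now left. destruct (Q x); reflexivity.
Qed.

Definition inset (p : point) : point := (fst p + 2, snd p).

(** Coordinates are those of the wider strip, in which [inset] has moved the old rows to 2, ..., m +
    1. *)
Definition rung_detour (m : Z) (e : edge) : list point :=
  let '((a, b), _) := e in
  if a =? 0 then [(0, b + 1); (1, b + 3)] else [(m + 3, b + 1); (m + 2, b + 3)].

Definition rim_detour (m : Z) (e : edge) : list point :=
  if rung m e then rung_detour m e
  else if rung m (swap e) then rev (rung_detour m (swap e)) else [].

Definition widen (m : Z) (es : list edge) : list edge :=
  flat_map (detour_walk inset (rim_detour m)) es.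

Lemma inset_sg m n k p : inset (sg m n k p) = sg (m + 4) n k (inset p).
Proof. unfold inset, sg; cbn [fst snd]; destruct (Z.even k); f_equal; lia. Qed.

Lemma rung_detour_sg m n k e : 4 <= m -> rung m e = true ->
  rung_detour m (sge m n k e) = map (sg (m + 4) n k) (rung_detour m e).
Proof.
  intros Hm; destruct e as [[a b] [a' b']]; rewrite rung_spec; intros [H ->].
  unfold sge, sg, rung_detour; cbn [fst snd].
  destruct H as [[-> ->]|[-> ->]]; destruct (Z.even k); cbn [fst snd];
  repeat match goal with
         | |- context [if ?x =? ?y then _ else _] => destruct (Z.eqb_spec x y); [|try lia]; try lia
         end; cbn [map fst snd]; repeat (f_equal; try lia).
Qed.

Lemma rung_swap m e : 4 <= m -> rung m e = true -> rung m (swap e) = false.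
Proof.
  intros Hm; destruct e as [[a b] [a' b']]; rewrite rung_spec; intros H.
  apply not_true_iff_false; unfold swap; cbn [fst snd]; rewrite rung_spec; lia.
Qed.

(** The sign [s] points into the strip, which lets one formula treat both sides. *)
Lemma rung_cases m e : 4 <= m -> rung m e = true -> exists a b,
  (a = 0 \/ a = m - 1) /\
  let s := if a =? 0 then 1 else -1 in
  e = ((a, b), (a + s, b + 2)) /\
  rung_detour m e = [(a + 2 - 2 * s, b + 1); (a + 2 - s, b + 3)].
Proof.
  intros Hm; destruct e as [[a b] [a' b']]; rewrite rung_spec; intros [H ->].
  exists a, b; split; [lia|]; cbn zeta; unfold rung_detour.
  destruct (Z.eqb_spec a 0); split; repeat (f_equal; try lia).
Qed.

(** Each of the [2 * n] rung orbits contributes two new vertices, in total the [4 * n] vertices of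
    the four new rows. Only the middle edge of a detour is a rung of the wider strip, so the rung
    count is preserved. *)
Lemma widen_rimmed_tour m n es : 4 <= m -> tour m n es -> rimmed m n es ->
  tour (m + 4) n (widen m es) /\ rimmed (m + 4) n (widen m es).
Proof.
  intros Hm Ht [Hc Hn].
  assert (Hlen : length (flat_map (rim_detour m) es) = (2 * length (filter (rim m) es))%nat).
  { clear Hc Hn Ht; induction es as [|e es IH]; [reflexivity|].
    cbn [flat_map filter]; rewrite length_app, IH; unfold rim_detour, rim.
    destruct (rung m e), (rung m (swap e)); cbn [orb length];
      destruct e as [[a b] [a' b']]; unfold swap; cbn; try destruct (_ =? 0); cbn; lia. }
  assert (Hwalk : forall e, rung m e = true ->
    exists x y, rung_detour m e = [x; y] /\ rung (m + 4) (x, y) = true /\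
      rim (m + 4) (inset (fst e), x) = false /\ rim (m + 4) (y, inset (snd e)) = false /\
      (strip_edge m (fst e) (snd e) -> strip_edge (m + 4) (inset (fst e)) x /\
        strip_edge (m + 4) x y /\ strip_edge (m + 4) y (inset (snd e)))).
  { intros e He; destruct (rung_cases m e Hm He) as (a & b & Ha & -> & ->).
    eexists _, _; split; [reflexivity|].
    unfold rim, swap, inset; cbn [fst snd].
    rewrite <- !not_true_iff_false, !orb_true_iff, !rung_spec.
    unfold strip_edge, in_strip, knight_adj; cbn [fst snd].
    destruct (Z.eqb_spec a 0); lia. }
  (* Old edges lie in rows 2 to m + 1, whereas a rung of the wider strip has an end in row 0 or m +
     3. *)
  assert (Hins : forall e, In e es -> rim m e = false -> rim (m + 4) (inset (fst e), inset (snd e)) = false).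
  { intros [[a b] [a' b']] He _; apply (tour_steps _ _ _ Ht) in He; cbn [fst snd] in *.
    unfold rim, swap, inset; cbn [fst snd].
    rewrite <- !not_true_iff_false, !orb_true_iff, !rung_spec.
    unfold strip_edge, in_strip in He; cbn [fst snd] in He; lia. }
  assert (Hdw : forall e, In e es ->
     (exists x y, rung m e = true /\ rung_detour m e = [x; y] /\
         detour_walk inset (rim_detour m) e = [(inset (fst e), x); (x, y); (y, inset (snd e))])
  \/ (exists x y, rung m (swap e) = true /\ rung_detour m (swap e) = [x; y] /\
         detour_walk inset (rim_detour m) e = [(inset (fst e), y); (y, x); (x, inset (snd e))])
  \/ (rim m e = false /\ detour_walk inset (rim_detour m) e = [(inset (fst e), inset (snd e))])).
  { intros e He; unfold detour_walk, rim_detour, rim.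
    destruct (rung m e) eqn:H1; [|destruct (rung m (swap e)) eqn:H2].
    - left. destruct (Hwalk e H1) as (x & y & Hxy & _); exists x, y. rewrite Hxy; auto.
    - right; left. destruct (Hwalk _ H2) as (x & y & Hxy & _); exists x, y. rewrite Hxy; auto.
    - right; right; auto. }
  assert (Hcov : forall e, rung m e = true -> exists k e', In e' es /\
      (rim_detour m e' = map (sg (m + 4) n k) (rung_detour m e) \/
       rim_detour m e' = rev (map (sg (m + 4) n k) (rung_detour m e)))).
  { intros e He; destruct (Hc e He) as (k & e' & He' & Hk); exists k, e'; split; [assumption|].
    rewrite <- rung_detour_sg by assumption; unfold rim_detour.
    destruct Hk as [-> | ->].
    - rewrite rung_sge, He; now left.
    - rewrite rung_sge, rung_swap by assumption.
      rewrite swap_sge, swap_swap, rung_sge, He; now right. }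
  split.
  - apply detour_tour with (m := m) (n := n); [assumption| | | |].
    + intros; apply inset_sg.
    + intros e e' He He'. pose proof (tour_steps _ _ _ Ht _ He) as Hs.
      destruct (Hdw e He) as [(x & y & H1 & H2 & H3)|[(x & y & H1 & H2 & H3)|[H1 H3]]]; rewrite H3 in He'.
      * destruct (Hwalk e H1) as (x' & y' & Hxy & _ & _ & _ & H); rewrite H2 in Hxy; injection Hxy as <- <-.
        specialize (H Hs). cbn in He'; intuition (subst; assumption).
      * destruct (Hwalk _ H1) as (x' & y' & Hxy & _ & _ & _ & H); rewrite H2 in Hxy; injection Hxy as <- <-.
        specialize (H (strip_edge_sym _ _ _ Hs)). cbn [swap fst snd] in H.
        cbn in He'; intuition (subst; apply strip_edge_sym; assumption).
      * destruct He' as [<-|[]]. cbn [fst snd].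
        revert Hs; unfold strip_edge, in_strip, knight_adj, inset; cbn [fst snd]; lia.
    + rewrite Hlen; lia.
    + intros [a b] Hq; unfold in_strip in Hq; cbn [fst] in Hq.
      assert (Hnew : forall a0 b0 a1, rung m ((a0, b0), (a1, b0 + 2)) = true ->
        In (a, b) (rung_detour m ((a0, b0), (a1, b0 + 2))) ->
        exists k e, In e es /\ In (sg (m + 4) n k (a, b)) (rim_detour m e)).
      { intros a0 b0 a1 Hr Hin; destruct (Hcov _ Hr) as (k & e & He & H); exists k, e.
        split; [assumption|]. destruct H as [-> | ->]; [|apply -> in_rev]; now apply in_map. }
      (* A vertex of an outermost row lies on the detour of the rung starting one column earlier; in
         the next row, three columns earlier. *)
      assert (Ha : a = 0 \/ a = 1 \/ a = m + 3 \/ a = m + 2 \/ 2 <= a < m + 2) by lia.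
      destruct Ha as [-> |[-> |[-> |[-> |Ha]]]].
      * right; apply (Hnew 0 (b - 1) 1); [rewrite rung_spec; lia|left; f_equal; lia].
      * right; apply (Hnew 0 (b - 3) 1); [rewrite rung_spec; lia|right; left; f_equal; lia].
      * right; apply (Hnew (m - 1) (b - 1) (m - 2)); [rewrite rung_spec; lia|].
        unfold rung_detour; destruct (Z.eqb_spec (m - 1) 0); [lia|]; left; f_equal; lia.
      * right; apply (Hnew (m - 1) (b - 3) (m - 2)); [rewrite rung_spec; lia|].
        unfold rung_detour; destruct (Z.eqb_spec (m - 1) 0); [lia|]; right; left; f_equal; lia.
      * left; exists 0, (a - 2, b); unfold in_strip; cbn [fst]; split; [lia|].
        rewrite sg_0; unfold inset; cbn [fst snd]; f_equal; lia.
  - split.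
    + intros [[a b] [a' b']] He. pose proof He as He0; rewrite rung_spec in He; destruct He as [Ha ->].
      (* A rung of the wider strip is the middle edge of the detour of the old rung that starts one
         column earlier. *)
      assert (Hr : exists e, rung m e = true /\ rung_detour m e = [(a, b); (a', b + 2)]).
      { destruct Ha as [[-> ->]|[-> ->]].
        - exists ((0, b - 1), (1, b - 1 + 2)); rewrite rung_spec; split; [lia|].
          unfold rung_detour; cbn; repeat (f_equal; try lia).
        - exists ((m - 1, b - 1), (m - 2, b - 1 + 2)); rewrite rung_spec; split; [lia|].
          unfold rung_detour; destruct (Z.eqb_spec (m - 1) 0); [lia|]; repeat (f_equal; try lia). }
      destruct Hr as (e & Hr & Hd); destruct (Hcov e Hr) as (k & e' & He' & H).
      rewrite Hd in H; exists k; destruct H as [H|H]; cbn in H.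
      * exists (sge (m + 4) n k ((a, b), (a', b + 2))); split; [|now left].
        apply in_flat_map; exists e'; split; [assumption|].
        unfold detour_walk; rewrite H; cbn; now right; left.
      * exists (sge (m + 4) n k (swap ((a, b), (a', b + 2)))); split; [|now right].
        apply in_flat_map; exists e'; split; [assumption|].
        unfold detour_walk; rewrite H; cbn; now right; left.
    + rewrite <- Hn; f_equal; apply length_filter_flat_map.
      intros e He.
      destruct (Hdw e He) as [(x & y & H1 & H2 & ->)|[(x & y & H1 & H2 & ->)|[H1 ->]]].
      * destruct (Hwalk e H1) as (x' & y' & Hxy & H3 & H4 & H5 & _).
        rewrite H2 in Hxy; injection Hxy as <- <-.
        cbn [filter]. rewrite H4, H5. unfold rim. rewrite H3, H1. reflexivity.
      * destruct (Hwalk _ H1) as (x' & y' & Hxy & H3 & H4 & H5 & _).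
        rewrite H2 in Hxy; injection Hxy as <- <-.
        cbn [filter]. rewrite <- rim_swap in H4, H5; unfold swap in H4, H5; cbn [fst snd] in H4, H5.
        rewrite H4, H5, <- rim_swap; unfold rim; rewrite H1, orb_true_r.
        unfold swap; cbn [fst snd]; rewrite H3; reflexivity.
      * cbn [filter]. rewrite Hins, H1 by assumption; reflexivity.
Qed.

(** * Lengthening the strip *)

Definition point_eqb (p q : point) : bool := (fst p =? fst q) && (snd p =? snd q).
Definition edge_eqb (e e' : edge) : bool :=
  point_eqb (fst e) (fst e') && point_eqb (snd e) (snd e').

Lemma point_eqb_eq p q : point_eqb p q = true <-> p = q.
Proof.
  destruct p, q; unfold point_eqb; cbn [fst snd].
  rewrite andb_true_iff, !Z.eqb_eq; split; [intros [-> ->]; reflexivity|].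
  intros H; injection H; auto.
Qed.

Lemma edge_eqb_eq e e' : edge_eqb e e' = true <-> e = e'.
Proof.
  destruct e, e'; unfold edge_eqb; cbn [fst snd].
  rewrite andb_true_iff, !point_eqb_eq; split; [intros [-> ->]; reflexivity|].
  intros H; injection H; auto.
Qed.

(* A strand (e, D) consists of an edge e crossing the cut between b = -1 and
   b = 0 and the interior D of the path which replaces it when a block
   -k <= b < 0 is inserted there. *)
Definition strand := (edge * list point)%type.

(* The cuts lie just before b = j n; for an edge crossing one, this is j. *)
Definition cut (n : Z) (e : edge) : Z := Z.max (snd (fst e) / n) (snd (snd e) / n).

(** The edge is first translated to the cut before column 0. A list is returned so that [flat_map]
    collects all strands which a tour uses; under [ins_inj] it has at most one entry. *)
Definition look (m n : Z) (tab : list strand) (e : edge) : list strand :=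
  filter (fun t => edge_eqb (fst t) (sge m n (- cut n e) e)) tab.

(** Columns [j * n], ..., [j * n + n - 1] move to start at [j * (n + k)], leaving a gap of [k]
    columns before each cut. *)
Definition stretch (k n : Z) (p : point) : point := (fst p, snd p + k * (snd p / n)).

Definition block_detour (m n k : Z) (tab : list strand) (e : edge) : list point :=
  flat_map (fun t => map (sg m (n + k) (cut n e)) (snd t)) (look m n tab e).

Definition lengthen (m n k : Z) (tab : list strand) (es : list edge) : list edge :=
  flat_map (detour_walk (stretch k n) (block_detour m n k tab)) es.

(** This is [stretch] near the cut before column 0, freed of [n], so that one table of strands
    serves every length. *)
Definition before_block (k : Z) (p : point) : point :=
  (fst p, if snd p <? 0 then snd p - k else snd p).

Definition strand_edges (k : Z) (t : strand) : list edge :=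
  detour_walk (before_block k) (fun _ => snd t) (fst t).

Definition crossing (e : edge) : bool := xorb (snd (fst e) <? 0) (snd (snd e) <? 0).

(** Neither [n] nor a tour occurs here, so these conditions are verified once for a whole family of
    lengths. *)
Record insertable (m k : Z) (tab : list strand) : Prop := {
  ins_key : forall t, In t tab -> -2 <= snd (fst (fst t)) < 2 /\ -2 <= snd (snd (fst t)) < 2;
  ins_step : forall t e, In t tab -> In e (strand_edges k t) -> strip_edge m (fst e) (snd e);
  ins_range : forall t e, In t tab -> In e (strand_edges k t) ->
    -k - 2 <= snd (fst e) < 2 /\ -k - 2 <= snd (snd e) < 2;
  (* The path crosses the new cut exactly once, along the edge it replaces. *)
  ins_cross : forall t, In t tab -> filter crossing (strand_edges k t) = [fst t];
  ins_inj : forall t, In t tab -> filter (fun t' => edge_eqb (fst t') (fst t)) tab = [t];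
  ins_cover : forall a b, 0 <= a < m -> -k <= b < 0 -> exists t, In t tab /\ In (a, b) (snd t);
  ins_length : Z.of_nat (length (flat_map snd tab)) = m * k }.

(** Up to [sigma], the tour crosses the cut exactly along the keys of the table, each of them
    once. *)
Record cuttable (m n : Z) (tab : list strand) (es : list edge) : Prop := {
  cut_found : forall e, In e es -> snd (fst e) / n <> snd (snd e) / n -> look m n tab e <> [];
  cut_once : Permutation (flat_map (look m n tab) es) tab }.

Lemma stretch_sg m n k j p : 0 < n ->
  stretch k n (sg m n j p) = sg m (n + k) j (stretch k n p).
Proof.
  intros Hn; unfold stretch, sg; cbn [fst snd].
  rewrite Z.div_add by lia; f_equal; lia.
Qed.

Lemma stretch_div n k b : 0 < n -> 0 <= k -> (b + k * (b / n)) / (n + k) = b / n.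
Proof.
  intros Hn Hk; pose proof (Z.div_mod b n ltac:(lia)) as Hd.
  pose proof (Z.mod_pos_bound b n Hn) as Hb.
  symmetry; apply Z.div_unique with (r := b mod n); lia.
Qed.

Lemma cut_sge m n j e : 0 < n -> cut n (sge m n j e) = j + cut n e.
Proof.
  intros Hn; unfold cut, sge, sg; cbn [fst snd].
  rewrite !Z.div_add by lia; lia.
Qed.

Lemma look_sge m n tab j e : 0 < n -> look m n tab (sge m n j e) = look m n tab e.
Proof.
  intros Hn; unfold look; rewrite cut_sge, sge_sge by assumption.
  now replace (- (j + cut n e) + j) with (- cut n e) by lia.
Qed.

Lemma div_small_neg b n : - n <= b < 0 -> b / n = -1.
Proof. intros H; symmetry; apply Z.div_unique with (r := b + n); lia. Qed.

Section Lengthen.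
Variables (m n k : Z) (tab : list strand).
Hypotheses (Hn : 2 <= n) (Hk : 0 <= k) (HT : insertable m k tab).

Lemma strand_key t : In t tab -> crossing (fst t) = true.
Proof.
  intros Ht; pose proof (ins_cross _ _ _ HT t Ht) as H.
  assert (Hi : In (fst t) (filter crossing (strand_edges k t))) by (rewrite H; now left).
  now apply filter_In in Hi.
Qed.

Lemma cut_crossing N (e : edge) :
  - N <= snd (fst e) < N -> - N <= snd (snd e) < N -> crossing e = true ->
  cut N e = 0 /\ snd (fst e) / N <> snd (snd e) / N.
Proof.
  destruct e as [[a u] [b v]]; unfold crossing, cut; cbn [fst snd]; intros Hu Hv.
  destruct (Z.ltb_spec u 0), (Z.ltb_spec v 0); intros; try discriminate.
  - rewrite (div_small_neg u), (Z.div_small v) by lia; lia.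
  - rewrite (div_small_neg v), (Z.div_small u) by lia; lia.
Qed.

Lemma not_crossing N (e : edge) :
  - N <= snd (fst e) < N -> - N <= snd (snd e) < N -> crossing e = false ->
  snd (fst e) / N = snd (snd e) / N.
Proof.
  destruct e as [[a u] [b v]]; unfold crossing; cbn [fst snd]; intros Hu Hv.
  destruct (Z.ltb_spec u 0), (Z.ltb_spec v 0); intros; try discriminate.
  - rewrite !div_small_neg by lia; reflexivity.
  - rewrite !Z.div_small by lia; reflexivity.
Qed.

(** Translated by its own cut, such an edge has both ends at nonnegative columns, whereas every key
    crosses column 0. *)
Lemma look_nil N (e : edge) : 0 < N -> snd (fst e) / N = snd (snd e) / N -> look m N tab e = [].
Proof.
  intros HN H; destruct (look m N tab e) as [|t l] eqn:Hl; [reflexivity|exfalso].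
  assert (Ht : In t (look m N tab e)) by (rewrite Hl; now left).
  apply filter_In in Ht as [Ht He]; apply edge_eqb_eq in He.
  pose proof (strand_key t Ht) as Hc; rewrite He in Hc; revert Hc.
  unfold crossing, cut, sge, sg; cbn [fst snd].
  destruct e as [[a u] [b v]]; cbn [fst snd] in *; rewrite <- H, Z.max_id.
  pose proof (Z.div_mod u N ltac:(lia)); pose proof (Z.mod_pos_bound u N HN).
  pose proof (Z.div_mod v N ltac:(lia)); pose proof (Z.mod_pos_bound v N HN).
  destruct (Z.ltb_spec (u + - (u / N) * N) 0); [lia|].
  destruct (Z.ltb_spec (v + - (u / N) * N) 0); [rewrite H in *; lia|]; discriminate.
Qed.

Lemma look_cases N (e : edge) : look m N tab e = [] \/
  exists t, In t tab /\ look m N tab e = [t] /\ e = sge m N (cut N e) (fst t).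
Proof.
  destruct (look m N tab e) as [|t l] eqn:Hl; [now left|right].
  assert (Ht : In t (look m N tab e)) by (rewrite Hl; now left).
  apply filter_In in Ht as [Ht He]; apply edge_eqb_eq in He.
  exists t; split; [assumption|]; split.
  - rewrite <- Hl, <- (ins_inj _ _ _ HT t Ht); unfold look; now rewrite He.
  - rewrite He, sge_sge, Z.add_opp_diag_r; symmetry; apply sge_0.
Qed.

(** Keys live in columns -2 to 1, so with a period of at least 2 the only cut they meet is the one
    numbered 0. *)
Lemma look_key N t : 2 <= N -> In t tab -> look m N tab (fst t) = [t].
Proof.
  intros HN Ht; destruct (ins_key _ _ _ HT t Ht).
  unfold look; rewrite (proj1 (cut_crossing N (fst t) ltac:(lia) ltac:(lia) (strand_key t Ht))).
  cbn [Z.opp]; rewrite sge_0; now apply (ins_inj _ _ _ HT).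
Qed.

(** A replacement path stays in columns from [-k - 2] to 1, hence within one period on either side
    of the new cut. It can therefore meet that cut only, and by [ins_cross] it does so once, along
    the key. *)
Lemma look_strand t : In t tab ->
  flat_map (look m (n + k) tab) (strand_edges k t) = [t].
Proof.
  intros Ht.
  transitivity (flat_map (look m (n + k) tab) (filter crossing (strand_edges k t))).
  - pose proof (fun e => ins_range _ _ _ HT t e Ht) as Hr; revert Hr.
    induction (strand_edges k t) as [|e l IH]; intros Hr; [reflexivity|].
    cbn [flat_map filter]; rewrite IH by (intros; apply Hr; now right).
    destruct (Hr e (or_introl eq_refl)).
    destruct (crossing e) eqn:Hc; [reflexivity|].
    rewrite look_nil; [reflexivity|lia|apply not_crossing; [lia|lia|assumption]].
  - rewrite (ins_cross _ _ _ HT t Ht); cbn [flat_map].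
    rewrite app_nil_r; apply look_key; [lia|assumption].
Qed.

Lemma stretch_before p : -2 <= snd p < 2 -> stretch k n p = before_block k p.
Proof.
  intros Hp; unfold stretch, before_block; destruct (Z.ltb_spec (snd p) 0).
  - rewrite div_small_neg by lia; f_equal; lia.
  - rewrite Z.div_small by lia; f_equal; lia.
Qed.

(** Equivariance of [stretch] and its agreement with [before_block] near the cut make the
    replacement of a crossing edge a translate of one fixed path. *)
Lemma lengthened_edge (e : edge) :
  (look m n tab e = [] /\
   detour_walk (stretch k n) (block_detour m n k tab) e = [(stretch k n (fst e), stretch k n (snd e))]) \/
  (exists t, In t tab /\ look m n tab e = [t] /\ e = sge m n (cut n e) (fst t) /\
     block_detour m n k tab e = map (sg m (n + k) (cut n e)) (snd t) /\
     detour_walk (stretch k n) (block_detour m n k tab) e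
     = map (sge m (n + k) (cut n e)) (strand_edges k t)).
Proof.
  destruct (look_cases n e) as [H|(t & Ht & H & He)]; [left|right].
  - unfold detour_walk, block_detour; rewrite H; auto.
  - exists t; repeat (split; [assumption|]).
    assert (Hb : block_detour m n k tab e = map (sg m (n + k) (cut n e)) (snd t)).
    { unfold block_detour; rewrite H; apply app_nil_r. }
    split; [assumption|].
    unfold strand_edges, detour_walk; rewrite Hb.
    destruct (ins_key _ _ _ HT t Ht) as [H1 H2].
    (* Only the two ends of [e] are rewritten as translates of the key; the occurrence inside
       [cut n e] stays. *)
    rewrite He at 1 3; unfold sge at 1 2; cbn [fst snd]; rewrite !stretch_sg by lia.
    rewrite !stretch_before by assumption.
    rewrite <- map_cons, walk_edges_map; reflexivity.
Qed.

(** Stretched edges cross no cut, and each inserted path crosses once, along its key. So the list of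
    strands met is unchanged, and lengthening can be repeated with the same table. *)
Lemma lengthen_cuttable es : cuttable m n tab es -> cuttable m (n + k) tab (lengthen m n k tab es).
Proof.
  intros [Hf Ho]; split.
  - intros e' He' Hne; apply in_flat_map in He' as (e & He & He').
    destruct (lengthened_edge e) as [(H & Hw)|(t & Ht & H & Hte & _ & Hw)]; rewrite Hw in He'.
    + destruct He' as [<-|[]]; exfalso; apply Hne; cbn [stretch fst snd].
      unfold stretch; cbn [fst snd]; rewrite !stretch_div by lia.
      destruct (Z.eq_dec (snd (fst e) / n) (snd (snd e) / n)); [assumption|].
      now destruct (Hf e He).
    + apply in_map_iff in He' as (s & <- & Hs); rewrite look_sge by lia.
      assert (Hc : crossing s = true).
      { destruct (crossing s) eqn:Hc; [reflexivity|].
        destruct (ins_range _ _ _ HT t s Ht Hs).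
        apply not_crossing with (N := n + k) in Hc; [|lia|lia].
        exfalso; apply Hne; unfold sge, sg; cbn [fst snd].
        rewrite !Z.div_add by lia; lia. }
      assert (Hi : In s (filter crossing (strand_edges k t))) by (apply filter_In; auto).
      rewrite (ins_cross _ _ _ HT t Ht) in Hi; destruct Hi as [<-|[]].
      rewrite look_key by (assumption || lia); discriminate.
  - etransitivity; [|exact Ho].
    replace (flat_map (look m (n + k) tab) (lengthen m n k tab es))
      with (flat_map (look m n tab) es); [reflexivity|].
    clear Ho; induction es as [|e es IH]; [reflexivity|].
    unfold lengthen; cbn [flat_map]; rewrite flat_map_app.
    rewrite IH by (intros; apply Hf; [now right|assumption]); f_equal.
    destruct (lengthened_edge e) as [(H & ->)|(t & Ht & H & _ & _ & ->)]; rewrite H.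
    + cbn [flat_map]; rewrite look_nil; [reflexivity|lia|].
      unfold stretch; cbn [fst snd]; rewrite !stretch_div by lia.
      destruct (Z.eq_dec (snd (fst e) / n) (snd (snd e) / n)); [assumption|].
      now destruct (Hf e (or_introl eq_refl)).
    + rewrite <- (look_strand t Ht).
      induction (strand_edges k t) as [|s l IHl]; [reflexivity|].
      cbn [map flat_map]; rewrite look_sge by lia; now rewrite IHl.
Qed.

(** The fundamental domain is chosen as the inserted block followed by the old columns 0, ..., n -
    1, on which [stretch] is the identity. *)
Lemma exists_norm q : exists j, 0 <= snd (sg m (n + k) j q) + k < n + k.
Proof.
  exists (- ((snd q + k) / (n + k))); unfold sg; cbn [snd].
  pose proof (Z.div_mod (snd q + k) (n + k) ltac:(lia)).
  pose proof (Z.mod_pos_bound (snd q + k) (n + k) ltac:(lia)); lia.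
Qed.

Lemma cut_every es t : cuttable m n tab es -> In t tab -> exists e, In e es /\ look m n tab e = [t].
Proof.
  intros Hc Ht; apply (Permutation_in _ (Permutation_sym (cut_once _ _ _ _ Hc))) in Ht.
  apply in_flat_map in Ht as (e & He & Ht); exists e; split; [assumption|].
  destruct (look_cases n e) as [H|(t' & _ & H & _)]; rewrite H in *; destruct Ht.
  - now subst.
  - contradiction.
Qed.

Lemma lengthen_tour es : tour m n es -> cuttable m n tab es -> tour m (n + k) (lengthen m n k tab es).
Proof.
  intros Ht Hc; apply detour_tour with (m := m) (n := n); [assumption| | | |].
  - intros; apply stretch_sg; lia.
  - intros e e' He He'; pose proof (tour_steps _ _ _ Ht e He) as Hs.
    destruct (lengthened_edge e) as [(H & Hw)|(t & Htt & H & Hte & _ & Hw)]; rewrite Hw in He'.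
    + destruct He' as [<-|[]].
      destruct (Z.eq_dec (snd (fst e) / n) (snd (snd e) / n)) as [Hq|Hq];
        [|now destruct (cut_found _ _ _ _ Hc e He Hq)].
      revert Hs; unfold stretch, strip_edge, in_strip, knight_adj; cbn [fst snd]; rewrite <- Hq.
      lia.
    + apply in_map_iff in He' as (s & <- & Hs'); unfold sge; cbn [fst snd].
      apply strip_edge_sg; now apply (ins_step _ _ _ HT t).
  (* Each strand is used by exactly one edge, so as many vertices are inserted as the table
     contains, namely [m * k]. *)
  - replace (length (flat_map (block_detour m n k tab) es)) with (length (flat_map snd tab)).
    + rewrite (ins_length _ _ _ HT); lia.
    + pose proof (Permutation_length (Permutation_flat_map snd (cut_once _ _ _ _ Hc))) as Hl.
      transitivity (length (flat_map snd (flat_map (look m n tab) es))); [congruence|]; clear Hl.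
      clear; induction es as [|e es IH]; [reflexivity|].
      cbn [flat_map]; rewrite flat_map_app, !length_app, <- IH; f_equal.
      unfold block_detour; induction (look m n tab e) as [|t l IHl]; [reflexivity|].
      cbn [flat_map]; rewrite !length_app, length_map, IHl; reflexivity.
  - intros q Hq; destruct (exists_norm q) as (j & Hj).
    set (q' := sg m (n + k) j q) in *.
    assert (Hq' : in_strip m q') by now apply in_strip_sg.
    assert (Hqq : q = sg m (n + k) (- j) q').
    { unfold q'; rewrite sg_sg, Z.add_opp_diag_l; symmetry; apply sg_0. }
    clearbody q'; subst q; destruct (Z_lt_dec (snd q') 0) as [Hlt|Hge].
    + right; destruct (ins_cover _ _ _ HT (fst q') (snd q') Hq' ltac:(lia)) as (t & Htt & Hin).
      destruct (cut_every es t Hc Htt) as (e & He & Hl).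
      exists (cut n e + j), e; split; [assumption|].
      unfold block_detour; rewrite Hl; cbn [flat_map]; rewrite app_nil_r, sg_sg.
      replace (cut n e + j + - j) with (cut n e) by lia.
      apply in_map; destruct q'; assumption.
    + left; exists (- j), q'; split; [assumption|].
      f_equal; unfold stretch; rewrite Z.div_small by lia; destruct q'; cbn [fst snd]; f_equal; lia.
Qed.

(** The range of [b] describes the rungs that touch or jump over the inserted block. The term
    [2 * k] is the growth of the number of rung orbits from [2 * n] to [2 * (n + k)]. *)
Record rim_insertable : Prop := {
  rimins_cover : forall a a' b, (a = 0 /\ a' = 1 \/ a = m - 1 /\ a' = m - 2) -> - k - 2 <= b < 0 ->
    exists t e, In t tab /\ In e (strand_edges k t) /\
      (e = ((a, b), (a', b + 2)) \/ e = swap ((a, b), (a', b + 2)));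
  rimins_count : Z.of_nat (length (filter (rim m) (flat_map (strand_edges k) tab)))
    = Z.of_nat (length (filter (rim m) (map fst tab))) + 2 * k }.

Lemma lengthen_rimmed es : tour m n es -> cuttable m n tab es -> rim_insertable ->
  rimmed m n es -> rimmed m (n + k) (lengthen m n k tab es).
Proof.
  intros Ht Hc [Hrc Hrn] [Hec Hen]; split.
  - intros e0 He0; destruct (exists_norm (fst e0)) as (j & Hj).
    assert (Hr : rung m (sge m (n + k) j e0) = true) by now rewrite rung_sge.
    assert (He1 : e0 = sge m (n + k) (- j) (sge m (n + k) j e0)).
    { rewrite sge_sge, Z.add_opp_diag_l; symmetry; apply sge_0. }
    enough (H : exists i e', In e' (lengthen m n k tab es) /\
      (e' = sge m (n + k) i (sge m (n + k) j e0) \/ e' = sge m (n + k) i (swap (sge m (n + k) j e0)))).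
    { destruct H as (i & e' & He' & H); exists (i + j), e'; split; [assumption|].
      rewrite swap_sge, !sge_sge in H; assumption. }
    change (snd (sg m (n + k) j (fst e0))) with (snd (fst (sge m (n + k) j e0))) in Hj.
    clear He1 He0; destruct (sge m (n + k) j e0) as [[a b] [a' b']].
    apply rung_spec in Hr as [Ha ->]; cbn [fst snd] in Hj; clear j e0.
    assert (Hblock : forall a a' b, (a = 0 /\ a' = 1 \/ a = m - 1 /\ a' = m - 2) -> - k - 2 <= b < 0 ->
      exists i e', In e' (lengthen m n k tab es) /\
      (e' = sge m (n + k) i ((a, b), (a', b + 2)) \/ e' = sge m (n + k) i (swap ((a, b), (a', b + 2))))).
    { clear a a' b Ha Hj; intros a a' b Ha Hb.
      destruct (Hrc a a' b Ha Hb) as (t & s & Htt & Hs & Hse).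
      destruct (cut_every es t Hc Htt) as (e & He & Hl).
      exists (cut n e), (sge m (n + k) (cut n e) s); split.
      - apply in_flat_map; exists e; split; [assumption|].
        destruct (lengthened_edge e) as [(H & _)|(t' & _ & H & _ & _ & ->)]; rewrite Hl in H;
          [discriminate|injection H as <-].
        now apply in_map.
      - destruct Hse as [-> | ->]; auto. }
    (* The rung starts in the block, or it leaves the old columns to the right and [sigma] to the
       power -1 brings it to the block before column 0, or it lies inside the old columns and is an
       unmoved old rung. *)
    assert (Hb : b < 0 \/ n - 2 <= b \/ 0 <= b < n - 2) by lia.
    destruct Hb as [Hb|[Hb|Hb]].
    + apply Hblock; [assumption|lia].
    + destruct (Hblock (m - 1 - a) (m - 1 - a') (b - (n + k))) as (i & e' & He' & H); [lia|lia|].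
      exists (i - 1), e'; split; [assumption|].
      replace ((m - 1 - a, b - (n + k)), (m - 1 - a', b - (n + k) + 2))
        with (sge m (n + k) (-1) ((a, b), (a', b + 2))) in H
        by (unfold sge, sg; cbn [Z.even fst snd]; repeat (f_equal; try lia)).
      rewrite swap_sge, !sge_sge in H; assumption.
    + destruct (Hec ((a, b), (a', b + 2))) as (i & e & He & H); [rewrite rung_spec; auto|].
      exists i, (stretch k n (fst e), stretch k n (snd e)); split.
      * apply in_flat_map; exists e; split; [assumption|].
        assert (Hq : snd (fst e) / n = snd (snd e) / n).
        { destruct H as [-> | ->]; unfold sge, swap, sg; cbn [fst snd];
            rewrite !Z.div_add, !Z.div_small by lia; reflexivity. }
        destruct (lengthened_edge e) as [(_ & ->)|(t & _ & H' & _)]; [now left|].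
        rewrite look_nil in H'; [discriminate|lia|assumption].
      * assert (Hst : forall c d, 0 <= d < n -> stretch k n (c, d) = (c, d)).
        { intros c d Hd; unfold stretch; cbn [fst snd]; rewrite Z.div_small by lia; f_equal; lia. }
        destruct H as [-> | ->]; [left|right]; unfold sge, swap; cbn [fst snd];
          rewrite !stretch_sg, !Hst by lia; reflexivity.
  - set (w := fun l => length (filter (rim m) l)).
    assert (Hw : forall l l', w (l ++ l') = (w l + w l')%nat).
    { intros; unfold w; now rewrite filter_app, length_app. }
    assert (Hwp : forall l l', Permutation l l' -> w l = w l').
    { intros l l' Hp; induction Hp; unfold w in *; cbn [filter]; try destruct (rim m x);
        try destruct (rim m y); cbn [length]; congruence. }
    (* The rung balance of a single edge is stated with sums on both sides to avoid truncated
       subtraction; adding it up over the tour gives [Hsum]. *)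
    assert (Hwe : forall e, In e es ->
      (w (detour_walk (stretch k n) (block_detour m n k tab) e) + w (map fst (look m n tab e)) =
       w [e] + w (flat_map (strand_edges k) (look m n tab e)))%nat).
    { intros e He; destruct (lengthened_edge e) as [(H & ->)|(t & Htt & H & Hte & _ & ->)]; rewrite H.
      - cbn [map flat_map]; f_equal.
        assert (Hq : snd (fst e) / n = snd (snd e) / n).
        { destruct (Z.eq_dec (snd (fst e) / n) (snd (snd e) / n)); [assumption|].
          now destruct (cut_found _ _ _ _ Hc e He). }
        unfold w; cbn [filter]; replace (rim m (stretch k n (fst e), stretch k n (snd e))) with (rim m e);
          [destruct (rim m e); reflexivity|].
        destruct e as [[a b] [a' b']]; cbn [fst snd] in *.
        unfold rim, swap, stretch, rung; cbn [fst snd]; rewrite <- Hq.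
        assert (Hsh : forall u v c, (u + c =? v + c + 2) = (u =? v + 2)).
        { intros; apply eq_true_iff_eq; rewrite !Z.eqb_eq; lia. }
        now rewrite !Hsh.
      - cbn [map flat_map]; rewrite app_nil_r, Nat.add_comm; f_equal.
        + rewrite Hte; unfold w; cbn [filter]; now rewrite rim_sge; destruct (rim m (fst t)).
        + unfold w; clear; induction (strand_edges k t) as [|s l IH]; [reflexivity|].
          cbn [map filter]; rewrite rim_sge; destruct (rim m s); cbn [length]; congruence. }
    assert (Hsum : (w (lengthen m n k tab es) + w (map fst (flat_map (look m n tab) es)) =
      w es + w (flat_map (strand_edges k) (flat_map (look m n tab) es)))%nat).
    { clearbody w; clear - Hw Hwe; unfold lengthen; induction es as [|e es IH]; [reflexivity|].
      cbn [flat_map]; rewrite map_app, flat_map_app, !Hw.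
      specialize (IH (fun e' He' => Hwe e' (or_intror He'))).
      specialize (Hwe e (or_introl eq_refl)).
      change (e :: es) with ([e] ++ es); rewrite Hw; unfold strand, point in *; lia. }
    pose proof (cut_once _ _ _ _ Hc) as Hp.
    rewrite (Hwp _ _ (Permutation_map fst Hp)), (Hwp _ _ (Permutation_flat_map _ Hp)) in Hsum.
    fold (w es) in Hen; unfold w in *; lia.
Qed.
End Lengthen.

(** * Decision procedures *)

Definition zrange (lo len : Z) : list Z := map (fun i => lo + Z.of_nat i) (seq 0 (Z.to_nat len)).

Lemma in_zrange lo len z : lo <= z < lo + len -> In z (zrange lo len).
Proof.
  intros H; apply in_map_iff; exists (Z.to_nat (z - lo)); split; [lia|].
  apply in_seq; lia.
Qed.

Lemma zrange_spec lo len z : In z (zrange lo len) -> lo <= z < lo + len.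
Proof.
  intros H; apply in_map_iff in H as (i & <- & Hi); apply in_seq in Hi; lia.
Qed.

Definition strip_edge_b (m : Z) (e : edge) : bool :=
  let '((a, b), (a', b')) := e in
  (0 <=? a) && (a <? m) && ((0 <=? a') && (a' <? m)) &&
  ((Z.abs (a - a') =? 1) && (Z.abs (b - b') =? 2) ||
   (Z.abs (a - a') =? 2) && (Z.abs (b - b') =? 1)).

Lemma strip_edge_b_spec m e : strip_edge_b m e = true <-> strip_edge m (fst e) (snd e).
Proof.
  destruct e as [[a b] [a' b']]; unfold strip_edge_b, strip_edge, in_strip, knight_adj; cbn [fst snd].
  rewrite !andb_true_iff, orb_true_iff, !andb_true_iff, !Z.leb_le, !Z.ltb_lt, !Z.eqb_eq; tauto.
Qed.

(** The canonical representative of an orbit, with column in 0, ..., n - 1; comparing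
    representatives decides [same_vertex]. *)
Definition rep (m n : Z) (p : point) : point := sg m n (- (snd p / n)) p.

Lemma rep_sg m n k p : 0 < n -> rep m n (sg m n k p) = rep m n p.
Proof.
  intros Hn; unfold rep; rewrite sg_sg; f_equal.
  unfold sg; cbn [snd]; rewrite Z.div_add by lia; lia.
Qed.

Lemma rep_range m n p : 0 < n -> 0 <= snd (rep m n p) < n.
Proof.
  intros Hn; unfold rep, sg; cbn [snd].
  pose proof (Z.div_mod (snd p) n ltac:(lia)); pose proof (Z.mod_pos_bound (snd p) n Hn); lia.
Qed.

Lemma rep_eq m n p q : rep m n p = rep m n q -> exists k, p = sg m n k q.
Proof. intros H; apply sg_inv in H; eauto. Qed.

Definition box (lo m len : Z) : list point := list_prod (zrange 0 m) (zrange lo len).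

Lemma rep_in_box m n p : 0 < n -> in_strip m p -> In (rep m n p) (box 0 m n).
Proof.
  intros Hn Hp; rewrite (surjective_pairing (rep m n p)); apply in_prod; apply in_zrange.
  - apply (in_strip_sg m n (- (snd p / n)) p) in Hp; exact Hp.
  - now apply rep_range.
Qed.

Definition tour_b (m n : Z) (es : list edge) : bool :=
  forallb (strip_edge_b m) es && (Z.of_nat (length es) =? m * n) &&
  forallb (fun q => existsb (fun e => point_eqb (rep m n (fst e)) q) es) (box 0 m n).

Definition found_b (m n : Z) (tab : list strand) (es : list edge) : bool :=
  forallb (fun e => (snd (fst e) / n =? snd (snd e) / n) || negb (length (look m n tab e) =? 0)%nat) es.

Definition cuttable_b (m n : Z) (tab : list strand) (es : list edge) : bool :=
  found_b m n tab es &&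
  (length (flat_map (look m n tab) es) <=? length tab)%nat &&
  forallb (fun t => existsb (fun t' => edge_eqb (fst t') (fst t)) (flat_map (look m n tab) es)) tab.

Definition within (lo hi : Z) (p : point) : bool := (lo <=? snd p) && (snd p <? hi).
Definition within2 (lo hi : Z) (e : edge) : bool := within lo hi (fst e) && within lo hi (snd e).

Definition insertable_b (m k : Z) (tab : list strand) : bool :=
  forallb (fun t =>
    within2 (-2) 2 (fst t) &&
    forallb (fun e => strip_edge_b m e && within2 (-k - 2) 2 e) (strand_edges k t) &&
    match filter crossing (strand_edges k t) with [e] => edge_eqb e (fst t) | _ => false end &&
    (length (filter (fun t' => edge_eqb (fst t') (fst t)) tab) =? 1)%nat) tab &&
  forallb (fun q => existsb (fun t => existsb (point_eqb q) (snd t)) tab) (box (-k) m k) &&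
  (Z.of_nat (length (flat_map snd tab)) =? m * k).

Definition rungs (m lo len : Z) : list edge :=
  flat_map (fun b => [((0, b), (1, b + 2)); ((m - 1, b), (m - 2, b + 2))]) (zrange lo len).

Definition rim_insertable_b (m k : Z) (tab : list strand) : bool :=
  forallb (fun r => existsb (fun e => edge_eqb e r || edge_eqb e (swap r)) (flat_map (strand_edges k) tab))
    (rungs m (- k - 2) (k + 2)) &&
  (Z.of_nat (length (filter (rim m) (flat_map (strand_edges k) tab)))
    =? Z.of_nat (length (filter (rim m) (map fst tab))) + 2 * k).

Definition nrm (m n : Z) (e : edge) : edge := sge m n (- (snd (fst e) / n)) e.

Definition rimmed_b (m n : Z) (es : list edge) : bool :=
  forallb (fun r => existsb (fun e =>
      edge_eqb (nrm m n e) (nrm m n r) || edge_eqb (nrm m n e) (nrm m n (swap r))) es)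
    (rungs m 0 n) &&
  (Z.of_nat (length (filter (rim m) es)) =? 2 * n).

Lemma tour_b_spec m n l : 0 < n ->
  tour_b m n (walk_edges l (sg m n 1 (hd (0, 0) l))) = true ->
  tour m n (walk_edges l (sg m n 1 (hd (0, 0) l))).
Proof.
  intros Hn; unfold tour_b; rewrite !andb_true_iff, !forallb_forall, Z.eqb_eq.
  intros [[Hs Hl] Hc]; split; [eauto| |assumption|].
  - intros e He; apply strip_edge_b_spec; auto.
  - intros q Hq; specialize (Hc (rep m n q)).
    pose proof (rep_in_box m n q Hn Hq) as Hb.
    apply Hc, existsb_exists in Hb as (e & He & Hb); apply point_eqb_eq, rep_eq in Hb as [k Hk].
    eauto.
Qed.

Lemma length_one_in {A} (l : list A) x : In x l -> length l = 1%nat -> l = [x].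
Proof.
  destruct l as [|y [|]]; cbn; try discriminate; intros [->|[]]; reflexivity.
Qed.

Lemma insertable_b_spec m k tab : insertable_b m k tab = true -> insertable m k tab.
Proof.
  unfold insertable_b; rewrite !andb_true_iff, !forallb_forall, Z.eqb_eq.
  intros [[Ht Hc] Hl].
  assert (Hw : forall lo hi e, within2 lo hi e = true ->
    lo <= snd (fst e) < hi /\ lo <= snd (snd e) < hi).
  { intros lo hi e; unfold within2, within; rewrite !andb_true_iff, !Z.leb_le, !Z.ltb_lt; tauto. }
  split; try assumption.
  - intros t H; apply Ht in H; rewrite !andb_true_iff in H; now apply Hw.
  - intros t e H He; apply Ht in H; rewrite !andb_true_iff, forallb_forall in H.
    destruct H as [[[_ H] _] _]; apply H, andb_true_iff in He as [He _].
    now apply strip_edge_b_spec.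
  - intros t e H He; apply Ht in H; rewrite !andb_true_iff, forallb_forall in H.
    destruct H as [[[_ H] _] _]; apply H, andb_true_iff in He as [_ He].
    now apply Hw.
  - intros t H; apply Ht in H; rewrite !andb_true_iff in H; destruct H as [[_ H] _].
    destruct (filter crossing (strand_edges k t)) as [|e [|]]; try discriminate.
    apply edge_eqb_eq in H; now subst.
  - intros t H; pose proof (Ht t H) as H'; rewrite !andb_true_iff in H'; destruct H' as [_ H'].
    apply length_one_in; [|now apply Nat.eqb_eq].
    apply filter_In; split; [assumption|now apply edge_eqb_eq].
  - intros a b Ha Hb; specialize (Hc (a, b)); rewrite existsb_exists in Hc.
    destruct Hc as (t & Htt & Hc); [apply in_prod; apply in_zrange; lia|].
    apply existsb_exists in Hc as (q & Hq & Hc); apply point_eqb_eq in Hc; subst; eauto.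
Qed.

(** A repeated strand would make its key occur twice, against [ins_inj]. *)
Lemma insertable_NoDup m k tab : insertable m k tab -> NoDup tab.
Proof.
  intros HT.
  assert (H : forall t, In t tab -> (length (filter (fun t' => edge_eqb (fst t') (fst t)) tab) <= 1)%nat).
  { intros t Ht; rewrite (ins_inj _ _ _ HT t Ht); cbn; lia. }
  clear HT; induction tab as [|t l IH]; constructor.
  - intros Ht; specialize (H t (or_introl eq_refl)); cbn [filter] in H.
    rewrite (proj2 (edge_eqb_eq _ _) eq_refl) in H; cbn [length] in H.
    assert (Hi : In t (filter (fun t' => edge_eqb (fst t') (fst t)) l)).
    { apply filter_In; split; [assumption|now apply edge_eqb_eq]. }
    apply in_split in Hi as (l1 & l2 & Hi); rewrite Hi, length_app in H; cbn [length] in H; lia.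
  - apply IH; intros t' Ht'; specialize (H t' (or_intror Ht')); cbn [filter] in H.
    destruct (edge_eqb (fst t) (fst t')); cbn [length] in H; lia.
Qed.

(** The table is free of duplicates, is contained in the list of strands met, and that list is no
    longer than the table; so the two are permutations of each other. *)
Lemma cuttable_b_spec m n k tab es :
  insertable m k tab -> cuttable_b m n tab es = true -> cuttable m n tab es.
Proof.
  intros HT; unfold cuttable_b, found_b; rewrite !andb_true_iff, !forallb_forall, Nat.leb_le.
  intros [[Hf Hl] Hi]; split.
  - intros e He Hne H; specialize (Hf e He); apply orb_true_iff in Hf as [Hf|Hf].
    + apply Z.eqb_eq in Hf; exact (Hne Hf).
    + rewrite H in Hf; discriminate.
  - symmetry; apply NoDup_Permutation_bis; [now apply (insertable_NoDup m k)|assumption|].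
    intros t Ht; specialize (Hi t Ht); apply existsb_exists in Hi as (t' & Ht' & Hi).
    enough (t' = t) by now subst.
    assert (Hin : In t' tab).
    { apply in_flat_map in Ht' as (e & _ & Ht'); now apply filter_In in Ht'. }
    assert (H : In t' (filter (fun t' => edge_eqb (fst t') (fst t)) tab)) by (apply filter_In; auto).
    rewrite (ins_inj _ _ _ HT t Ht) in H; now destruct H.
Qed.

Lemma rungs_spec m lo len a b a' : lo <= b < lo + len ->
  (a = 0 /\ a' = 1 \/ a = m - 1 /\ a' = m - 2) -> In ((a, b), (a', b + 2)) (rungs m lo len).
Proof.
  intros Hb Ha; apply in_flat_map; exists b; split; [now apply in_zrange|].
  destruct Ha as [[-> ->]|[-> ->]]; [now left|now right; left].
Qed.

Lemma rim_insertable_b_spec m k tab : rim_insertable_b m k tab = true -> rim_insertable m k tab.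
Proof.
  unfold rim_insertable_b; rewrite andb_true_iff, forallb_forall, Z.eqb_eq.
  intros [H1 H2]; split; [|assumption].
  intros a a' b Ha Hb; specialize (H1 _ (rungs_spec m (-k-2) (k+2) a b a' ltac:(lia) Ha)).
  apply existsb_exists in H1 as (e & He & H1); apply in_flat_map in He as (t & Ht & He).
  exists t, e; repeat (split; [assumption|]).
  rewrite orb_true_iff, !edge_eqb_eq in H1; assumption.
Qed.

Lemma rimmed_b_spec m n es : 0 < n -> rimmed_b m n es = true -> rimmed m n es.
Proof.
  intros Hn; unfold rimmed_b; rewrite andb_true_iff, forallb_forall, Z.eqb_eq.
  intros [H1 H2]; split; [|assumption].
  intros e He.
  (* The boolean test runs only over rungs starting in columns 0 to n - 1, so the given rung is
     first moved there. *)
  assert (Hsh : exists j, 0 <= snd (fst (sge m n j e)) < n).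
  { exists (- (snd (fst e) / n)); apply (rep_range m n (fst e) Hn). }
  destruct Hsh as [j Hj]; rewrite <- (rung_sge m n j) in He.
  set (r := sge m n j e) in *.
  assert (Hr : In r (rungs m 0 n)).
  { clearbody r; destruct r as [[a b] [a' b']]; apply rung_spec in He as [Ha ->].
    apply rungs_spec; [exact Hj|assumption]. }
  apply H1, existsb_exists in Hr as (e' & He' & Hr).
  assert (Hn' : forall x y, nrm m n x = nrm m n y -> exists i, x = sge m n i y).
  { intros [x x'] [y y'] H; unfold nrm, sge in H; cbn [fst snd] in H.
    injection H as Hx1 Hx2 Hy1 Hy2.
    eexists; unfold sge; cbn [fst snd]; f_equal; (eapply sg_inv; unfold sg; f_equal; eassumption). }
  rewrite orb_true_iff, !edge_eqb_eq in Hr; unfold r in Hr.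
  destruct Hr as [Hr|Hr]; apply Hn' in Hr as [i ->]; rewrite ?swap_sge, sge_sge in *;
    exists (i + j); eexists; split; eauto.
Qed.

(** * Tours for all admissible boards *)

(** The eighth move, caught by the wildcard, is written as the digit 7. *)
Definition knight_move (c : ascii) : Z * Z :=
  match c with
  | "0" => (1, 2) | "1" => (1, -2) | "2" => (2, 1) | "3" => (2, -1)
  | "4" => (-1, 2) | "5" => (-1, -2) | "6" => (-2, 1) | _ => (-2, -1)
  end%char.

Fixpoint trail (s : string) (p : point) : list point :=
  match s with
  | EmptyString => []
  | String c s' =>
      let q := (fst p + fst (knight_move c), snd p + snd (knight_move c)) in q :: trail s' q
  end.

(* The closing step from the end of [s] to sigma (0, 0) is implicit. *)
Definition circuit (m n : Z) (s : string) : list edge :=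
  walk_edges ((0, 0) :: trail s (0, 0)) (sg m n 1 (0, 0)).

(** The flag asks for the rungs that widening needs; widths 3 and 5 are only lengthened and go
    without. *)
Definition has_tour (rims : bool) (m n : Z) : Prop :=
  exists es, tour m n es /\ (rims = true -> rimmed m n es).

Lemma circuit_has_tour rims m n s : 0 < n ->
  tour_b m n (circuit m n s) && implb rims (rimmed_b m n (circuit m n s)) = true ->
  has_tour rims m n.
Proof.
  intros Hn H; apply andb_true_iff in H as [Ht Hr]; exists (circuit m n s); split.
  - exact (tour_b_spec m n _ Hn Ht).
  - intros ->; exact (rimmed_b_spec m n _ Hn Hr).
Qed.

(* ((a, b), s) stands for the crossing edge starting at (a, b), together with
   the path s from (a, b - k) across the block to the end of that edge. *)
Definition block_strand (k : Z) (x : point * string) : strand :=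
  let '((a, b), s) := x in
  let l := trail s (a, b - k) in (((a, b), last l (0, 0)), removelast l).

(* A tour may traverse a strand in either direction. *)
Definition orient (m n : Z) (es : list edge) (t : strand) : strand :=
  if existsb (fun e => edge_eqb (sge m n (- cut n e) e) (fst t)) es then t
  else (swap (fst t), rev (snd t)).

Definition family_b (rims : bool) (m n k : Z) (s : string) (blk : list (point * string)) : bool :=
  let es := circuit m n s in
  let tab := map (fun x => orient m n es (block_strand k x)) blk in
  tour_b m n es && insertable_b m k tab && cuttable_b m n tab es &&
  implb rims (rimmed_b m n es && rim_insertable_b m k tab).

(** Induction on the number of inserted blocks with a fixed table: the conditions on the table do
    not involve the length, and [cuttable] survives each insertion. *)
Lemma family_has_tour rims m n k s blk j : 2 <= n /\ 0 <= k ->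
  family_b rims m n k s blk = true -> has_tour rims m (n + k * Z.of_nat j).
Proof.
  intros [Hn Hk] H; unfold family_b in H.
  set (tab := map _ blk) in H; clearbody tab.
  rewrite !andb_true_iff in H; destruct H as [[[Ht Hi] Hc] Hr].
  apply insertable_b_spec in Hi.
  assert (Hri : rims = true -> rim_insertable m k tab).
  { intros ->; cbn [implb] in Hr; apply andb_true_iff in Hr as [_ Hr].
    now apply rim_insertable_b_spec. }
  enough (exists es, tour m (n + k * Z.of_nat j) es /\ cuttable m (n + k * Z.of_nat j) tab es /\
    (rims = true -> rimmed m (n + k * Z.of_nat j) es)) as (es & H1 & _ & H2) by (exists es; auto).
  induction j as [|j (es & H1 & H2 & H3)].
  - rewrite Z.mul_0_r, Z.add_0_r; exists (circuit m n s); split; [|split].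
    + exact (tour_b_spec m n _ ltac:(lia) Ht).
    + exact (cuttable_b_spec m n k tab _ Hi Hc).
    + intros ->; cbn [implb] in Hr; apply andb_true_iff in Hr as [Hr _].
      exact (rimmed_b_spec m n _ ltac:(lia) Hr).
  - replace (n + k * Z.of_nat (S j)) with (n + k * Z.of_nat j + k) by lia.
    exists (lengthen m (n + k * Z.of_nat j) k tab es); split; [|split].
    + apply lengthen_tour; assumption || lia.
    + apply lengthen_cuttable; assumption || lia.
    + intros Hrims; apply lengthen_rimmed; auto; lia.
Qed.

(** Paths filling 4 columns. One block per width serves several starting tours, since all of them
    cross the cut along the same edges up to orientation. *)
Definition block3 : list (point * string) :=
  [((0, -1), "040"%string);
   ((2, -2), "404"%string);
   ((2, -1), "601601626"%string)].

Definition block5 : list (point * string) :=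
  [((0, -1), "040"%string);
   ((2, -1), "60124534652257426"%string);
   ((4, -2), "404"%string)].

Definition block6 : list (point * string) :=
  [((0, -2), "040"%string);
   ((0, -1), "040"%string);
   ((2, -1), "601065212453466"%string);
   ((5, -2), "46034"%string);
   ((5, -1), "404"%string)].

Definition block7 : list (point * string) :=
  [((0, -2), "040"%string);
   ((0, -1), "040"%string);
   ((1, -1), "24702"%string);
   ((2, -1), "6010124545266"%string);
   ((4, -1), "24702"%string);
   ((6, -2), "404"%string);
   ((6, -1), "404"%string)].

Definition block8 : list (point * string) :=
  [((0, -2), "040"%string);
   ((0, -1), "040"%string);
   ((2, -1), "60346"%string);
   ((3, -2), "404"%string);
   ((5, -1), "24610174547010102"%string);
   ((7, -2), "404"%string);
   ((7, -1), "47024"%string)].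

Definition block9 : list (point * string) :=
  [((0, -2), "040"%string);
   ((0, -1), "030254760"%string);
   ((2, -1), "60253016760323160165646"%string);
   ((8, -2), "404"%string);
   ((8, -1), "404"%string)].

Lemma tour_3_3 : has_tour false 3 3.
Proof. apply circuit_has_tour with (s := "04017345"%string); [lia|vm_compute; reflexivity]. Qed.

Lemma tours_3_5 j : has_tour false 3 (5 + 4 * Z.of_nat j).
Proof.
  apply family_has_tour with (blk := block3) (s := "01601601516006"%string);
    [lia|vm_compute; reflexivity].
Qed.

Lemma tours_3_6 j : has_tour false 3 (6 + 4 * Z.of_nat j).
Proof.
  apply family_has_tour with (blk := block3) (s := "26015160045251604"%string);
    [lia|vm_compute; reflexivity].
Qed.

Lemma tours_3_7 j : has_tour false 3 (7 + 4 * Z.of_nat j).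
Proof.
  apply family_has_tour with (blk := block3) (s := "37117004524040404537"%string);
    [lia|vm_compute; reflexivity].
Qed.

Lemma tours_3_8 j : has_tour false 3 (8 + 4 * Z.of_nat j).
Proof.
  apply family_has_tour with (blk := block3) (s := "35404340701600624515245"%string);
    [lia|vm_compute; reflexivity].
Qed.

Lemma tour_5_2 : has_tour false 5 2.
Proof. apply circuit_has_tour with (s := "031624653"%string); [lia|vm_compute; reflexivity]. Qed.

Lemma tours_5_3 j : has_tour false 5 (3 + 4 * Z.of_nat j).
Proof.
  apply family_has_tour with (blk := block5) (s := "37324046522562"%string);
    [lia|vm_compute; reflexivity].
Qed.

Lemma tours_5_4 j : has_tour false 5 (4 + 4 * Z.of_nat j).
Proof.
  apply family_has_tour with (blk := block5) (s := "2346534216615130406"%string);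
    [lia|vm_compute; reflexivity].
Qed.

Lemma tours_5_5 j : has_tour false 5 (5 + 4 * Z.of_nat j).
Proof.
  apply family_has_tour with (blk := block5) (s := "234047532574031760216610"%string);
    [lia|vm_compute; reflexivity].
Qed.

Lemma tours_5_6 j : has_tour false 5 (6 + 4 * Z.of_nat j).
Proof.
  apply family_has_tour with (blk := block5) (s := "23446153240404751513047154226"%string);
    [lia|vm_compute; reflexivity].
Qed.

Lemma tour_6_1 : has_tour true 6 1.
Proof. apply circuit_has_tour with (s := "01703"%string); [lia|vm_compute; reflexivity]. Qed.

Lemma tours_6_3 j : has_tour true 6 (3 + 4 * Z.of_nat j).
Proof.
  apply family_has_tour with (blk := block6) (s := "01602652603431516"%string);
    [lia|vm_compute; reflexivity].
Qed.

Lemma tours_6_5 j : has_tour true 6 (5 + 4 * Z.of_nat j).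
Proof.
  apply family_has_tour with (blk := block6) (s := "04032457523160162470016752316"%string);
    [lia|vm_compute; reflexivity].
Qed.

Lemma tour_7_1 : has_tour true 7 1.
Proof. apply circuit_has_tour with (s := "016031"%string); [lia|vm_compute; reflexivity]. Qed.

Lemma tours_7_2 j : has_tour true 7 (2 + 4 * Z.of_nat j).
Proof.
  apply family_has_tour with (blk := block7) (s := "3324621766023"%string);
    [lia|vm_compute; reflexivity].
Qed.

Lemma tours_7_3 j : has_tour true 7 (3 + 4 * Z.of_nat j).
Proof.
  apply family_has_tour with (blk := block7) (s := "33760403317760256022"%string);
    [lia|vm_compute; reflexivity].
Qed.

Lemma tours_7_4 j : has_tour true 7 (4 + 4 * Z.of_nat j).
Proof.
  apply family_has_tour with (blk := block7) (s := "316537006040256024553010170"%string);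
    [lia|vm_compute; reflexivity].
Qed.

Lemma tours_7_5 j : has_tour true 7 (5 + 4 * Z.of_nat j).
Proof.
  apply family_has_tour with (blk := block7) (s := "3334511734675324534460404024702215"%string);
    [lia|vm_compute; reflexivity].
Qed.

Lemma tour_8_1 : has_tour true 8 1.
Proof. apply circuit_has_tour with (s := "3452003"%string); [lia|vm_compute; reflexivity]. Qed.

Lemma tours_8_3 j : has_tour true 8 (3 + 4 * Z.of_nat j).
Proof.
  apply family_has_tour with (blk := block8) (s := "03301774604023707321516"%string);
    [lia|vm_compute; reflexivity].
Qed.

Lemma tours_8_5 j : has_tour true 8 (5 + 4 * Z.of_nat j).
Proof.
  apply family_has_tour with (blk := block8) (s := "370045212451601316245245247024676030315"%string);
    [lia|vm_compute; reflexivity].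
Qed.

Lemma tour_9_1 : has_tour true 9 1.
Proof. apply circuit_has_tour with (s := "34530003"%string); [lia|vm_compute; reflexivity]. Qed.

Lemma tour_9_2 : has_tour true 9 2.
Proof. apply circuit_has_tour with (s := "35537034307022462"%string); [lia|vm_compute; reflexivity]. Qed.

Lemma tours_9_3 j : has_tour true 9 (3 + 4 * Z.of_nat j).
Proof.
  apply family_has_tour with (blk := block9) (s := "01604023216762543347321516"%string);
    [lia|vm_compute; reflexivity].
Qed.

Lemma tours_9_4 j : has_tour true 9 (4 + 4 * Z.of_nat j).
Proof.
  apply family_has_tour with (blk := block9) (s := "02134564530231601624047601316710116"%string);
    [lia|vm_compute; reflexivity].
Qed.

Lemma tours_9_5 j : has_tour true 9 (5 + 4 * Z.of_nat j).
Proof.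
  apply family_has_tour with (blk := block9) (s := "04032034511701661124671760132340466251675232"%string);
    [lia|vm_compute; reflexivity].
Qed.

Lemma tours_9_6 j : has_tour true 9 (6 + 4 * Z.of_nat j).
Proof.
  apply family_has_tour with (blk := block9) (s := "37022461257323452404612404707065120016677017021031515"%string);
    [lia|vm_compute; reflexivity].
Qed.

(** * Assembling all admissible board sizes *)

Lemma has_tour_widen m n i : 4 <= m -> has_tour true m n -> has_tour true (m + 4 * Z.of_nat i) n.
Proof.
  intros Hm H; induction i as [|i (es & Ht & Hr)].
  - now rewrite Z.mul_0_r, Z.add_0_r.
  - replace (m + 4 * Z.of_nat (S i)) with (m + 4 * Z.of_nat i + 4) by lia.
    destruct (widen_rimmed_tour (m + 4 * Z.of_nat i) n es ltac:(lia) Ht (Hr eq_refl)).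
    exists (widen (m + 4 * Z.of_nat i) es); auto.
Qed.

Lemma residue_mod_4 z c : c <= z -> exists j : nat,
  z = c + 4 * Z.of_nat j \/ z = c + 1 + 4 * Z.of_nat j \/
  z = c + 2 + 4 * Z.of_nat j \/ z = c + 3 + 4 * Z.of_nat j.
Proof.
  intros H; exists (Z.to_nat ((z - c) / 4)).
  Z.to_euclidean_division_equations; lia.
Qed.

Lemma has_tour_3 n : n = 3 \/ 5 <= n -> has_tour false 3 n.
Proof.
  intros [-> | Hn]; [exact tour_3_3|].
  destruct (residue_mod_4 n 5 Hn) as [j [-> | [-> | [-> | ->]]]];
    [apply tours_3_5|apply tours_3_6|apply tours_3_7|apply tours_3_8].
Qed.

Lemma has_tour_5 n : 2 <= n -> has_tour false 5 n.
Proof.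
  intros Hn; destruct (Z.eq_dec n 2) as [-> | Hne]; [exact tour_5_2|].
  destruct (residue_mod_4 n 3 ltac:(lia)) as [j [-> | [-> | [-> | ->]]]];
    [apply tours_5_3|apply tours_5_4|apply tours_5_5|apply tours_5_6].
Qed.

Lemma has_tour_7 n : 1 <= n -> has_tour true 7 n.
Proof.
  intros Hn; destruct (Z.eq_dec n 1) as [-> | Hne]; [exact tour_7_1|].
  destruct (residue_mod_4 n 2 ltac:(lia)) as [j [-> | [-> | [-> | ->]]]];
    [apply tours_7_2|apply tours_7_3|apply tours_7_4|apply tours_7_5].
Qed.

Lemma has_tour_9 n : 1 <= n -> has_tour true 9 n.
Proof.
  intros Hn; destruct (Z.eq_dec n 1) as [-> | Hne]; [exact tour_9_1|].
  destruct (Z.eq_dec n 2) as [-> | Hne']; [exact tour_9_2|].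
  destruct (residue_mod_4 n 3 ltac:(lia)) as [j [-> | [-> | [-> | ->]]]];
    [apply tours_9_3|apply tours_9_4|apply tours_9_5|apply tours_9_6].
Qed.

Lemma has_tour_6_8 n m : Z.Odd n -> 1 <= n -> m = 6 \/ m = 8 -> has_tour true m n.
Proof.
  intros [c Hc] Hn Hm; destruct (Z.eq_dec n 1) as [-> | Hne].
  { destruct Hm as [-> | ->]; [exact tour_6_1|exact tour_8_1]. }
  destruct (residue_mod_4 n 3 ltac:(lia)) as [j [-> | [-> | [-> | ->]]]]; try lia;
    destruct Hm as [-> | ->];
    [apply tours_6_3|apply tours_8_3|apply tours_6_5|apply tours_8_5].
Qed.

Lemma has_tour_exists m n : 0 < m -> 0 < n ->
  ~ ((Z.Even m /\ Z.Even n) \/ (m = 1 \/ m = 2 \/ m = 4) \/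
     (m = 3 /\ (n = 1 \/ n = 2 \/ n = 4)) \/ (m = 5 /\ n = 1)) ->
  exists es, tour m n es.
Proof.
  intros Hm Hn Hex.
  enough (exists rims, has_tour rims m n) as (rims & es & H & _) by eauto.
  destruct (Z.eq_dec m 3) as [-> | H3]; [exists false; apply has_tour_3; lia|].
  destruct (Z.eq_dec m 5) as [-> | H5]; [exists false; apply has_tour_5; lia|].
  (* All remaining widths are at least 6, hence arise from 6, 7, 8 or 9 by repeated widening. *)
  exists true; destruct (residue_mod_4 m 6 ltac:(lia)) as [j Hj].
  assert (Hodd : Z.Even m -> Z.Odd n).
  { intros Hm'; destruct (Z.Even_or_Odd n); [tauto|assumption]. }
  destruct Hj as [-> | [-> | [-> | ->]]]; apply has_tour_widen; try lia.
  - apply has_tour_6_8; [|lia|lia]; apply Hodd; exists (3 + 2 * Z.of_nat j); lia.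
  - apply has_tour_7; lia.
  - apply has_tour_6_8; [|lia|lia]; apply Hodd; exists (4 + 2 * Z.of_nat j); lia.
  - apply has_tour_9; lia.
Qed.

(** * Generating tours from edge lists *)

Lemma length_zrange lo len : length (zrange lo len) = Z.to_nat len.
Proof. unfold zrange; now rewrite length_map, length_seq. Qed.

Lemma NoDup_zrange lo len : NoDup (zrange lo len).
Proof.
  apply NoDup_map_inv with (f := fun z => Z.to_nat (z - lo)); unfold zrange; rewrite map_map.
  rewrite (map_ext _ id) by (intros; unfold id; lia); rewrite map_id; apply seq_NoDup.
Qed.

Lemma NoDup_list_prod {A B} (l : list A) (l' : list B) :
  NoDup l -> NoDup l' -> NoDup (list_prod l l').
Proof.
  intros Hl Hl'; induction Hl as [|x l Hx Hl IH]; cbn [list_prod]; [constructor|].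
  apply NoDup_app; [|assumption|].
  - apply NoDup_map_NoDup_ForallPairs; [|assumption].
    intros y y' _ _ H; now injection H.
  - intros p Hp Hp'; apply in_map_iff in Hp as (y & <- & _).
    now apply in_prod_iff in Hp'.
Qed.

Lemma NoDup_box lo m n : NoDup (box lo m n).
Proof. apply NoDup_list_prod; apply NoDup_zrange. Qed.

Lemma length_box lo m n : length (box lo m n) = (Z.to_nat m * Z.to_nat n)%nat.
Proof. etransitivity; [apply length_prod|]; now rewrite !length_zrange. Qed.

Lemma box_rep m n p : In p (box 0 m n) -> in_strip m p /\ rep m n p = p.
Proof.
  destruct p as [a b]; intros H; apply in_prod_iff in H as [Ha Hb].
  apply zrange_spec in Ha, Hb; split; [exact Ha|].
  unfold rep; cbn [snd]; rewrite Z.div_small by lia; apply sg_0.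
Qed.

(** Pigeonhole: the [m * n] representatives visited cover a box of [m * n] vertices. *)
Lemma tour_NoDup m n es : 0 < m -> 0 < n -> tour m n es -> NoDup (map (rep m n) (map fst es)).
Proof.
  intros Hm Hn Ht; apply (@NoDup_incl_NoDup _ (box 0 m n)).
  - apply NoDup_box.
  - rewrite length_box, !length_map.
    pose proof (tour_length _ _ _ Ht); lia.
  - intros q Hq; apply box_rep in Hq as [Hq Hr].
    destruct (tour_cover _ _ _ Ht q Hq) as (k & e & He & Hk).
    rewrite <- Hr, <- (rep_sg m n k q Hn), <- Hk; now do 2 apply in_map.
Qed.

Lemma in_walk_edges l z i d : (i < length l)%nat ->
  In (nth i l d, nth (S i) (l ++ [z]) d) (walk_edges l z).
Proof.
  revert i; induction l as [|p l IH]; cbn [length]; intros i Hi; [lia|].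
  destruct i as [|i].
  - left; destruct l; reflexivity.
  - right; apply (IH i); lia.
Qed.

(** The walk of [es] need not start over (0, 0). It is extended periodically, a window of [N] steps
    starting over (0, 0) is cut out, and a power of [sigma] moves the start of that window to (0, 0)
    itself. *)
Lemma tour_has_generating_tour m n es : 0 < m -> 0 < n -> tour m n es -> has_generating_tour m n.
Proof.
  intros Hm Hn Ht; pose proof (tour_NoDup m n es Hm Hn Ht) as Hnd.
  destruct Ht as [[l Hl] Hs Hlen Hc].
  set (z := sg m n 1 (hd (0, 0) l)) in *.
  assert (Hfst : map fst es = l) by (rewrite Hl; apply map_fst_walk_edges).
  set (N := Z.to_nat (m * n)).
  assert (HN : length l = N) by (rewrite <- Hfst, length_map; unfold N; lia).
  assert (HN0 : (0 < N)%nat) by (unfold N; nia).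
  rewrite Hfst in Hnd.
  set (x := fun i => nth i l (0, 0)).
  (* The periodic extension: each full round of [N] steps applies [sigma] once more. *)
  set (w := fun i => sg m n (Z.of_nat (i / N)) (x (i mod N)%nat)).
  assert (Hinj : forall i j k, (i < N)%nat -> (j < N)%nat -> x i = sg m n k (x j) -> i = j).
  { intros i j k Hi Hj H; apply (f_equal (rep m n)) in H; rewrite rep_sg in H by assumption.
    apply (proj1 (NoDup_nth (map (rep m n) l) (rep m n (0, 0))) Hnd);
      rewrite ?length_map, ?HN; try assumption.
    rewrite !map_nth; exact H. }
  assert (Hcov : forall q, in_strip m q -> exists i k, (i < N)%nat /\ x i = sg m n k q).
  { intros q Hq; destruct (Hc q Hq) as (k & e & He & Hk).
    apply (in_map fst) in He; rewrite Hfst in He.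
    apply (In_nth _ _ (0, 0)) in He as (i & Hi & Hx).
    exists i, k; rewrite <- HN, <- Hk; auto. }
  assert (Hper : forall i, w (i + N)%nat = sg m n 1 (w i)).
  { intros i; unfold w; rewrite sg_sg.
    replace (i + N)%nat with (i + 1 * N)%nat by lia.
    rewrite Nat.Div0.mod_add, Nat.div_add by lia; f_equal; lia. }
  assert (Hadj : forall i, strip_edge m (w i) (w (S i))).
  { assert (Hstep : forall i, (i < N)%nat -> strip_edge m (w i) (w (S i))).
    { intros i Hi; rewrite <- HN in Hi; pose proof (in_walk_edges l z i (0, 0) Hi) as He.
      rewrite <- Hl in He; apply Hs in He; cbn [fst snd] in He; rewrite HN in Hi.
      assert (Hw : forall i, (i < N)%nat -> w i = x i).
      { intros j Hj; unfold w; rewrite Nat.div_small, Nat.mod_small by assumption; apply sg_0. }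
      rewrite Hw by assumption.
      destruct (Nat.eq_dec (S i) N) as [HSi|HSi].
      - rewrite app_nth2, HN, HSi, Nat.sub_diag in He by lia.
        replace (w (S i)) with z; [exact He|].
        rewrite HSi; change N with (0 + N)%nat; rewrite Hper, Hw by assumption.
        unfold z, x; destruct l; reflexivity.
      - rewrite app_nth1 in He by lia; rewrite Hw by lia; exact He. }
    intros i; induction i as [i IH] using lt_wf_ind.
    destruct (Nat.lt_ge_cases i N) as [Hi|Hi]; [now apply Hstep|].
    replace i with (i - N + N)%nat by lia.
    change (S (i - N + N)) with (S (i - N) + N)%nat.
    rewrite !Hper; apply strip_edge_sg, IH; lia. }
  (* Here [r] is the time at which the walk visits the orbit of (0, 0), and [k] tells which lift it
     meets there. *)
  destruct (Hcov (0, 0)) as (r & k & Hr & Hk); [unfold in_strip; cbn; lia|].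
  assert (Hw0 : sg m n (- k) (w r) = (0, 0)).
  { unfold w; rewrite Nat.div_small, Nat.mod_small by assumption.
    cbn [Z.of_nat]; rewrite sg_0, Hk, sg_sg, Z.add_opp_diag_l; apply sg_0. }
  assert (HwN : sg m n (- k) (w (r + N)%nat) = (m - 1, n)).
  { rewrite Hper, sg_sg, Z.add_comm, <- sg_sg, Hw0; unfold sg; cbn [Z.even fst snd]; f_equal; lia. }
  exists (fun i => sg m n (- k) (w (r + i)%nat)); split.
  - unfold is_lifted_tour; fold N; cbn zeta; repeat apply conj.
    + now rewrite Nat.add_0_r.
    + intros i _; rewrite Nat.add_succ_r; apply strip_edge_sg, Hadj.
    + intros i j Hi Hj H; apply same_vertex_sg in H as [c H].
      unfold w in H; rewrite !sg_sg in H; apply sg_inv in H.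
      apply Hinj in H; [|apply Nat.mod_upper_bound; lia..].
      (* Two times with the same residue modulo [N] in a window of length [N] coincide. *)
      pose proof (Nat.div_mod_eq (r + i) N); pose proof (Nat.div_mod_eq (r + j) N).
      rewrite H in *; clear H.
      destruct (Nat.lt_trichotomy ((r + i) / N) ((r + j) / N)) as [H|[H|H]]; nia.
    + intros q Hq; destruct (Hcov q Hq) as (i & c & Hi & Hx).
      (* The window starting at [r] contains every residue modulo [N]; times before [r] are reached
         one round later. *)
      assert (Hmod : exists t, (t < N)%nat /\ ((r + t) mod N)%nat = i).
      { destruct (Nat.le_gt_cases r i).
        - exists (i - r)%nat; split; [lia|]; rewrite Nat.mod_small; lia.
        - exists (i + N - r)%nat; split; [lia|].
          replace (r + (i + N - r))%nat with (i + 1 * N)%nat by lia.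
          rewrite Nat.Div0.mod_add; now apply Nat.mod_small. }
      destruct Hmod as (t & Htl & Ht); exists t; split; [assumption|].
      apply same_vertex_sg; unfold w; rewrite Ht, Hx, !sg_sg; eauto.
    + rewrite Nat.add_0_r; apply same_vertex_sg; exists 1.
      now rewrite Hper, !sg_sg, Z.add_comm.
  - left; exact HwN.
Qed.

(** * Boards without generating tours *)

Lemma walk_parity m n w i : is_lifted_tour m n w -> (i <= Z.to_nat (m * n))%nat ->
  exists c, fst (w i) + snd (w i) = Z.of_nat i + 2 * c.
Proof.
  intros (H0 & Hs & _) Hi; induction i as [|i IH].
  - exists 0; rewrite H0; reflexivity.
  - destruct IH as [c Hc]; [lia|].
    destruct (Hs i ltac:(lia)) as (_ & _ & Hk); unfold knight_adj in Hk.
    exists ((fst (w (S i)) + snd (w (S i)) - Z.of_nat (S i)) / 2).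
    Z.to_euclidean_division_equations; lia.
Qed.

(** After the even number [m * n] of moves the coordinate sum is even, but at (m - 1, n) and (m - 1,
    -n) it is odd. *)
Lemma no_tour_even m n w : 0 < m -> 0 < n -> Z.Even m -> Z.Even n ->
  is_lifted_tour m n w -> ~ is_generating_lift m n w.
Proof.
  intros Hm Hn [a ->] [b ->] Ht Hg.
  destruct (walk_parity _ _ _ _ Ht (le_n _)) as [c Hc].
  rewrite Z2Nat.id in Hc by nia.
  destruct Hg as [Hg|Hg]; rewrite Hg in Hc; cbn [fst snd] in Hc; nia.
Qed.

Lemma no_tour_1 n w : 0 < n -> ~ is_lifted_tour 1 n w.
Proof.
  intros Hn (_ & Hs & _); destruct (Hs 0%nat ltac:(lia)) as (H1 & H2 & H3).
  unfold in_strip, knight_adj in *; lia.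
Qed.

(** After [2 * n] moves the walk is back in row 0, while a generating lift ends in row 1. *)
Lemma no_tour_2 n w : 0 < n -> is_lifted_tour 2 n w -> ~ is_generating_lift 2 n w.
Proof.
  intros Hn (H0 & Hs & _) Hg.
  assert (H : forall i, (i <= Z.to_nat (2 * n))%nat -> exists c, fst (w i) = Z.of_nat i + 2 * c).
  { induction i as [|i IH]; intros Hi; [exists 0; now rewrite H0|].
    destruct IH as [c Hc]; [lia|].
    destruct (Hs i ltac:(lia)) as (H1 & H2 & H3); unfold in_strip, knight_adj in *.
    exists ((fst (w (S i)) - Z.of_nat (S i)) / 2).
    Z.to_euclidean_division_equations; lia. }
  destruct (H _ (le_n _)) as [c Hc].
  destruct Hg as [Hg|Hg]; rewrite Hg in Hc; cbn [fst] in Hc; lia.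
Qed.

Definition inner (p : point) : bool := (fst p =? 1) || (fst p =? 2).

Lemma inner_sg n k p : inner (sg 4 n k p) = inner p.
Proof.
  unfold inner, sg; cbn [fst]; destruct (Z.even k); [reflexivity|].
  apply eq_true_iff_eq; rewrite !orb_true_iff, !Z.eqb_eq; lia.
Qed.

(* Outer rows are joined only to inner ones, and there are as many inner as
   outer vertices, so a tour alternates between them. *)
Lemma no_tour_4 n w : 0 < n -> Z.Odd n -> ~ is_lifted_tour 4 n w.
Proof.
  intros Hn [c0 Hodd] Ht; pose proof Ht as (H0 & Hs & Hd & Hc & Hz).
  set (N := Z.to_nat (4 * n)) in *.
  set (h := Z.to_nat (2 * n)); assert (HN : N = (2 * h)%nat) by (unfold N, h; lia).
  assert (Hnext : forall i, (i < N)%nat -> inner (w i) = false -> inner (w (S i)) = true).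
  { intros i Hi; destruct (Hs i Hi) as (H1 & H2 & H3); unfold inner, in_strip, knight_adj in *.
    rewrite orb_false_iff, orb_true_iff, !Z.eqb_eq, !Z.eqb_neq; lia. }
  (* Each pair of times 2i, 2i + 1 contains an inner vertex, which [f] selects. A pair with two of
     them would give [h + 1] distinct inner vertices, one more than the [2 * n] available. *)
  assert (Hpair : forall i, (i < h)%nat -> inner (w (2 * i)%nat) = true -> inner (w (2 * i + 1)%nat) = false).
  { intros i0 Hi0 Hin; apply not_true_iff_false; intros Hin'.
    set (f := fun i => if inner (w (2 * i)%nat) then (2 * i)%nat else (2 * i + 1)%nat).
    set (L := (2 * i0 + 1)%nat :: map f (seq 0 h)).
    assert (Hf : forall i, f i = (2 * i)%nat \/ f i = (2 * i + 1)%nat).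
    { intros i; unfold f; destruct (inner (w (2 * i)%nat)); auto. }
    assert (HL : forall i, In i L -> (i < N)%nat /\ inner (w i) = true).
    { intros i [<-|Hi]; [split; [lia|assumption]|].
      apply in_map_iff in Hi as (j & <- & Hj); apply in_seq in Hj; destruct (Hf j); split; try lia.
      - unfold f in *; destruct (inner (w (2 * j)%nat)) eqn:E; [exact E|lia].
      - unfold f in *; destruct (inner (w (2 * j)%nat)) eqn:E; [exact E|].
        rewrite Nat.add_1_r; apply Hnext; [lia|exact E]. }
    assert (HLnd : NoDup L).
    { constructor.
      - intros Hi; apply in_map_iff in Hi as (j & Hj & _).
        unfold f in Hj; destruct (inner (w (2 * j)%nat)) eqn:E; [lia|].
        replace j with i0 in E by lia; congruence.
      - apply NoDup_map_NoDup_ForallPairs; [|apply seq_NoDup].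
        intros i j _ _ H; destruct (Hf i), (Hf j); lia. }
    assert (Hlen : (length (map (fun i => rep 4 n (w i)) L) <=
                     length (list_prod (zrange 1 2) (zrange 0 n)))%nat).
    { apply NoDup_incl_length.
      - apply NoDup_map_NoDup_ForallPairs; [|assumption].
        intros i j Hi Hj H; apply HL in Hi, Hj; apply rep_eq in H as [k H].
        symmetry; apply Hd; [tauto..|]; apply same_vertex_sg; eauto.
      - intros q Hq; apply in_map_iff in Hq as (i & <- & Hi); apply HL in Hi as [_ Hi].
        rewrite (surjective_pairing (rep 4 n (w i))); apply in_prod; apply in_zrange.
        + rewrite <- (inner_sg n (- (snd (w i) / n))) in Hi.
          change (sg 4 n (- (snd (w i) / n)) (w i)) with (rep 4 n (w i)) in Hi.
          unfold inner in Hi; rewrite orb_true_iff, !Z.eqb_eq in Hi; lia.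
        + now apply rep_range. }
    rewrite length_map, length_prod, !length_zrange in Hlen.
    unfold L in Hlen; cbn [length] in Hlen; rewrite length_map, length_seq in Hlen.
    unfold h in Hlen; lia. }
  assert (HwN : inner (w N) = false).
  { apply same_vertex_sg in Hz as [k Hz]; rewrite Hz, inner_sg, H0; reflexivity. }
  (* Backward induction from the closing vertex, which is outer: an inner vertex at time 2i would
     force an outer one at 2i + 1 and then an inner one at 2i + 2. *)
  assert (Hstay : forall d i, (i + d = h)%nat -> inner (w (2 * i)%nat) = false).
  { induction d as [|d IH]; intros i Hi.
    - rewrite Nat.add_0_r in Hi; subst i; now rewrite <- HN.
    - apply not_true_iff_false; intros Hin; pose proof (Hpair i ltac:(lia) Hin) as Hout.
      apply Hnext in Hout; [|lia].
      replace (S (2 * i + 1)) with (2 * (S i))%nat in Hout by lia.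
      rewrite (IH (S i)) in Hout by lia; discriminate. }
  (* For odd [n] every lift of the outer vertex (0, 1) has odd coordinate sum, so it is visited at
     an odd time; but the vertices at odd times are inner. *)
  destruct (Hc (0, 1)) as (i & Hi & Hsv); [unfold in_strip; cbn; lia|].
  apply same_vertex_sg in Hsv as [k Hk].
  destruct (walk_parity _ _ _ i Ht ltac:(lia)) as [c Hpar].
  assert (Hout : inner (w i) = false) by (rewrite Hk, inner_sg; reflexivity).
  destruct (Nat.Even_or_Odd i) as [[j Hj]|[j Hj]].
  - rewrite Hk in Hpar; unfold sg in Hpar; cbn [fst snd] in Hpar.
    destruct (Z.even k) eqn:Ek.
    + apply Z.even_spec in Ek as [e Ek]; nia.
    + rewrite <- Z.negb_odd in Ek; apply negb_false_iff, Z.odd_spec in Ek as [e Ek]; nia.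
  - assert (Hj' : inner (w (2 * j)%nat) = false) by (apply (Hstay (h - j)%nat); lia).
    apply Hnext in Hj'; [|lia].
    replace (S (2 * j)) with i in Hj' by lia; congruence.
Qed.

(** * Exhaustive search on the small boards *)

Definition knight_neighbours (p : point) : list point :=
  map (fun d => (fst p + fst d, snd p + snd d))
    [(1, 2); (1, -2); (2, 1); (2, -1); (-1, 2); (-1, -2); (-2, 1); (-2, -1)].

Lemma knight_neighbours_spec p q : knight_adj p q -> In q (knight_neighbours p).
Proof.
  destruct p as [a b], q as [a' b']; unfold knight_adj; cbn [fst snd]; intros H.
  assert (Hd : In (a' - a, b' - b) [(1, 2); (1, -2); (2, 1); (2, -1); (-1, 2); (-1, -2); (-2, 1); (-2, -1)]).
  { assert (Hx : (a' - a = 1 \/ a' - a = -1) /\ (b' - b = 2 \/ b' - b = -2) \/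
                 (a' - a = 2 \/ a' - a = -2) /\ (b' - b = 1 \/ b' - b = -1)) by lia.
    destruct Hx as [[[-> | ->] [-> | ->]]|[[-> | ->] [-> | ->]]]; cbn; tauto. }
  apply in_map_iff; exists (a' - a, b' - b); split; [cbn; f_equal; lia|exact Hd].
Qed.

(* The recursive call sits under an [if] because [andb] would evaluate it eagerly. *)
Fixpoint search (m n : Z) (fuel : nat) (seen : list point) (p : point) : bool :=
  match fuel with
  | O => existsb (fun q => point_eqb q (m - 1, n) || point_eqb q (m - 1, - n)) (knight_neighbours p)
  | S fuel' =>
      existsb (fun q =>
        if (0 <=? fst q) && (fst q <? m) && negb (existsb (point_eqb (rep m n q)) seen)
        then search m n fuel' (rep m n q :: seen) q else false) (knight_neighbours p)
  end.

(** A generating tour is itself a branch on which the search succeeds: distinctness of its vertices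
    keeps each next one out of [seen]. *)
Lemma search_complete m n : 0 < n -> has_generating_tour m n ->
  search m n (Z.to_nat (m * n) - 1) [(0, 0)] (0, 0) = true \/ m * n <= 0.
Proof.
  intros Hn (w & (H0 & Hs & Hd & _ & _) & Hg); unfold is_generating_lift in Hg.
  set (N := Z.to_nat (m * n)) in *.
  destruct (Z.le_gt_cases (m * n) 0) as [|Hmn]; [now right|left].
  assert (HN : (0 < N)%nat) by (unfold N; lia).
  (* The fuel runs out at the last vertex, [w (N - 1)], so that the base case of [search] tests the
     closing step. Only representatives of vertices already visited are in [seen]. *)
  assert (H : forall fuel i seen, (i + fuel + 1 = N)%nat ->
    (forall q, In q seen -> exists j, (j <= i)%nat /\ q = rep m n (w j)) ->
    search m n fuel seen (w i) = true).
  { induction fuel as [|fuel IH]; intros i seen Hi Hseen; cbn [search]; apply existsb_exists.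
    - exists (w (S i)); destruct (Hs i ltac:(lia)) as (_ & _ & H).
      split; [now apply knight_neighbours_spec|].
      replace (S i) with N by lia; rewrite orb_true_iff, !point_eqb_eq; exact Hg.
    - exists (w (S i)); destruct (Hs i ltac:(lia)) as (_ & Hin & H).
      split; [now apply knight_neighbours_spec|].
      unfold in_strip in Hin; apply andb_true_iff; rewrite !andb_true_iff, negb_true_iff, Z.leb_le, Z.ltb_lt.
      repeat split; try lia.
      + apply not_true_iff_false; intros He; apply existsb_exists in He as (q & Hq & He).
        apply point_eqb_eq in He; destruct (Hseen q Hq) as (j & Hj & ->).
        apply rep_eq in He as [k He].
        assert (j = S i) by (apply Hd; [lia|lia|apply same_vertex_sg; eauto]); lia.
      + apply IH; [lia|]; intros q [<-|Hq]; [exists (S i); split; [lia|reflexivity]|].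
        destruct (Hseen q Hq) as (j & Hj & Hqj); exists j; split; [lia|assumption]. }
  rewrite <- H0 at 2; apply H; [lia|].
  intros q [<-|[]]; exists 0%nat; split; [lia|].
  rewrite H0; unfold rep; cbn [snd]; rewrite Z.div_small by lia; symmetry; apply sg_0.
Qed.

Lemma no_tour_small m n : search m n (Z.to_nat (m * n) - 1) [(0, 0)] (0, 0) = false ->
  0 < m -> 0 < n -> ~ has_generating_tour m n.
Proof.
  intros H Hm Hn Ht; destruct (search_complete m n Hn Ht) as [Hs|Hs]; [congruence|nia].
Qed.

Theorem theorem5p1 (m n : Z) (hm : 0 < m) (hn : 0 < n) :
  has_generating_tour m n <->
  ~ ( (Z.Even m /\ Z.Even n) \/
      (m = 1 \/ m = 2 \/ m = 4) \/
      (m = 3 /\ (n = 1 \/ n = 2 \/ n = 4)) \/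
      (m = 5 /\ n = 1) ).
Proof.
  split.
  - intros Ht Hex; pose proof Ht as (w & Hw & Hg).
    destruct Hex as [[He Hn]|[[-> |[-> | ->]]|[[-> [-> |[-> | ->]]]|[-> ->]]]].
    + exact (no_tour_even m n w hm hn He Hn Hw Hg).
    + exact (no_tour_1 n w hn Hw).
    + exact (no_tour_2 n w hn Hw Hg).
    + destruct (Z.Even_or_Odd n) as [Hn|Hn].
      * exact (no_tour_even 4 n w hm hn ltac:(exists 2; reflexivity) Hn Hw Hg).
      * exact (no_tour_4 n w hn Hn Hw).
    + revert Ht; apply no_tour_small; [vm_compute; reflexivity|lia|lia].
    + revert Ht; apply no_tour_small; [vm_compute; reflexivity|lia|lia].
    + revert Ht; apply no_tour_small; [vm_compute; reflexivity|lia|lia].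
    + revert Ht; apply no_tour_small; [vm_compute; reflexivity|lia|lia].
  - intros Hex; destruct (has_tour_exists m n hm hn Hex) as [es Hes].
    exact (tour_has_generating_tour m n es hm hn Hes).
Qed.
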